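(* Let $p(\cdot)$ be a variable exponent on $\mathbb{R}^d$ and let $\alpha,q$ be constants with $p(\cdot)\le\alpha\le q\le\infty$. Then $\left(L^{p(\cdot)},\ell^{q}\right)^{\alpha}$, equipped with $\|\cdot\|_{p(\cdot),q,\alpha}$, is a Banach function space on $\mathbb{R}^d$ satisfying the Fatou property.
   Context: $L^0$ is the set of (a.e.-equivalence classes of) measurable complex-valued functions on $\mathbb{R}^d$, and $L^0_+$ the set of its nonnegative elements. A variable exponent is a measurable function $p(\cdot):\mathbb{R}^d\to[1,\infty]$. The Luxemburg norm is $\|f\|_{p(\cdot)}=\inf\{\lambda>0:\int_{\mathbb{R}^d}(|f(x)|/\lambda)^{p(x)}dx\le1\}$ (with $\inf\varnothing=\infty$, and for $p(x)=\infty$ the convention $t^\infty=0$ if $0\le t\le1$, $t^\infty=\infty$ if $t>1$). $L^{p(\cdot)}$ is the set of measurable $f$ with $\|f\|_{p(\cdot)}<\infty$, and $L^{p(\cdot)}_{\rm loc}$ is the set of measurable $f$ with $f\chi_K\in L^{p(\cdot)}$ for every compact $K\subset\mathbb{R}^d$. For $k\in\mathbb{Z}^d$, $r>0$, $I_k^r=\prod_{j=1}^d[rk_j,r(k_j+1))$. For $1\le q\le\infty$, $\|f\|_{p(\cdot),q}=\big\|\{\|f\chi_{I_k^1}\|_{p(\cdot)}\}_{k\in\mathbb{Z}^d}\big\|_{\ell^q}$. For $\rho>0$, $St_\rho^{(\alpha)}f(x)=\rho^{-d/\alpha}f(\rho^{-1}x)$ (with $d/\infty=0$). The variable exponent Fofana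 space is $\left(L^{p(\cdot)},\ell^{q}\right)^{\alpha}=\{f\in L^{p(\cdot)}_{\rm loc}:\|f\|_{p(\cdot),q,\alpha}<\infty\}$, where $\|f\|_{p(\cdot),q,\alpha}=\sup_{\rho>0}\|St_\rho^{(\alpha)}f\|_{p(\cdot),q}$. A function norm on $\mathbb{R}^d$ is a map $\sigma:L^0_+\to[0,\infty]$ such that for all $f,g\in L^0_+$ and real $\lambda\ge0$: $\sigma(f)=0\iff f=0$; $\sigma(\lambda f)=\lambda\sigma(f)$; $\sigma(f+g)\le\sigma(f)+\sigma(g)$; $f\le g$ a.e. implies $\sigma(f)\le\sigma(g)$. The normed Köthe space defined by $\sigma$ is $X^\sigma=\{f\in L^0:\sigma(|f|)<\infty\}$ with norm $\|f\|_{X^\sigma}=\sigma(|f|)$; it is a Banach function space if it is complete. A normed Köthe space $X$ satisfies the Fatou property if for every sequence $(f_n)_{n\ge1}$ in $X$ with $0\le f_n\uparrow f$ in $L^0$ and $\sup_n\|f_n\|_X<\infty$ one has $f\in X$ and $\lim_n\|f_n\|_X=\|f\|_X$. *)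

(* Defs.v *)
From HB Require Import structures.
From mathcomp Require Import all_boot all_order all_algebra.
From mathcomp Require Import all_classical all_reals all_analysis.
From mathcomp Require Import measurable_realfun.
From mathcomp Require Export complex.

Set Implicit Arguments.
Unset Strict Implicit.
Unset Printing Implicit Defensive.
Import Order.TTheory GRing.Theory Num.Theory.
Import numFieldNormedType.Exports.
Local Open Scope classical_set_scope.
Local Open Scope ring_scope.

(* Euclidean space is indexed by its dimension minus one: [euclid R n] is
   R^(n+1), so that n : nat ranges exactly over the dimensions d >= 1. *)
Definition euclid (R : realType) (n : nat) := 'rV[R]_n.+1.

HB.instance Definition _ (R : realType) (n : nat) :=
  GRing.Lmodule.copy (euclid R n) 'rV[R]_n.+1.
HB.instance Definition _ (R : realType) (n : nat) :=
  PointedTopological.copy (euclid R n) 'rV[R]_n.+1.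

Section lebesgue.
Context (R : realType) (n : nat).
Local Open Scope ereal_scope.
Implicit Types (a b : euclid R n) (A : set (euclid R n)).

Definition box a b : set (euclid R n) :=
  [set x | forall j, (a ord0 j <= x ord0 j < b ord0 j)%R].

Definition box_vol a b : R :=
  (\prod_(j < n.+1) Num.max 0 (b ord0 j - a ord0 j))%R.

Definition box_cover A : set (nat -> euclid R n * euclid R n) :=
  [set c | A `<=` \bigcup_k box (c k).1 (c k).2].

Definition lebesgue_outer A : \bar R :=
  ereal_inf [set \sum_(k <oo) (box_vol (c k).1 (c k).2)%:E | c in box_cover A].

Lemma box_vol_ge0 a b : (0 <= box_vol a b)%R.
Proof. by apply: prodr_ge0 => j _; rewrite le_max lexx. Qed.

Lemma lebesgue_outer_ge0 A : 0 <= lebesgue_outer A.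
Proof.
apply: le_ereal_inf_tmp => x [c _ <-]; apply: nneseries_ge0 => k _ _.
by rewrite lee_fin box_vol_ge0.
Qed.

Lemma lebesgue_outer0 : lebesgue_outer set0 = 0.
Proof.
apply/eqP; rewrite eq_le lebesgue_outer_ge0 andbT.
apply: ereal_inf_lbound; exists (fun=> (0, 0)%R); first by move=> x.
apply: eseries0 => k _ _ /=.
by rewrite /box_vol big_ord_recl subrr maxxx mul0r.
Qed.

Lemma le_lebesgue_outer : {homo lebesgue_outer : A B / A `<=` B >-> A <= B}.
Proof.
move=> A B AB; apply/ereal_inf_le_tmp => x [c Bc <-].
by exists c => //; exact: subset_trans Bc.
Qed.

Lemma lebesgue_outer_sigma_subadditive : sigma_subadditive lebesgue_outer.
Proof.
move=> A; have [[i ioo]|] := pselect (exists i, lebesgue_outer (A i) = +oo).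
  rewrite (eseries_pinfty _ _ ioo) ?leey// => m _.
  by rewrite -ltNye (lt_le_trans _ (lebesgue_outer_ge0 _)).
rewrite -forallNE => Aoo.
pose v (c : euclid R n * euclid R n) := (box_vol c.1 c.2)%:E.
have v0 c : 0 <= v c by rewrite lee_fin box_vol_ge0.
suff add2e (e : {posnum R}) : lebesgue_outer (\bigcup_m A m) <=
    \sum_(i <oo) lebesgue_outer (A i) + e%:num%:E.
  by apply/lee_addgt0Pr => _/posnumP[].
rewrite (le_trans _ (epsilon_trick _ _ _))//; last first.
  by move=> m; exact: lebesgue_outer_ge0.
pose P m (c : nat -> euclid R n * euclid R n) := box_cover (A m) c /\
  \sum_(k <oo) v (c k) <= lebesgue_outer (A m) + (e%:num / (2 ^ m.+1)%:R)%:E.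
have [G PG] : {G & forall m, P m (G m)}.
  apply: (@choice _ _ P) => m; rewrite /P.
  have en1 : (0 < e%:num / (2 ^ m.+1)%:R :> R)%R by [].
  have fA : lebesgue_outer (A m) \is a fin_num.
    by rewrite ge0_fin_numE ?lebesgue_outer_ge0// ltey; exact/eqP/Aoo.
  have [x [c Ac <-] xS] := lb_ereal_inf_adherent en1 fA.
  by exists c; split => //; exact/ltW.
have vG0 x : 0 <= (v \o uncurry G) x by exact: v0.
apply: (@le_trans _ _ (\esum_(i in setT) (v \o uncurry G) i)).
  apply: ereal_inf_lbound => /=.
  have /card_esym/ppcard_eqP[f] := card_nat2.
  exists (uncurry G \o f).
    move=> t [i _ Ait]; have [k _ tk] := (PG i).1 _ Ait.
    by exists (f^-1%FUN (i, k)) => //=; rewrite invK ?inE.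
  rewrite -(esum_pred_image (v \o uncurry G) _ xpredT) ?[fun=> _]set_true//.
  by rewrite image_eq.
rewrite (_ : esum _ _ = \sum_(i <oo) \sum_(j <oo) v (G i j)); last first.
  pose J : nat -> set (nat * nat) := fun i => [set (i, j) | j in setT].
  rewrite (_ : setT = \bigcup_k J k); last first.
    by rewrite predeqE => -[a b]; split => // _; exists a => //; exists b.
  rewrite esum_bigcupT /=; last 2 first.
    - apply/trivIsetP => i j _ _ ij.
      rewrite predeqE => -[k m] /=; split => //= -[] [_] _ [<-{k} _].
      by move=> [m' _] [] /esym/eqP; rewrite (negbTE ij).
    - by move=> /= [k m].
  rewrite -(image_id [set: nat]) -fun_true esum_pred_image//; last first.
    by move=> m _; exact: esum_ge0.
  apply: eq_eseriesr => /= j _.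
  rewrite -(esum_pred_image (v \o uncurry G) (pair j) predT)//=; last first.
    by move=> ? ? _ _; exact: (@can_inj _ _ _ snd).
  by congr esum; rewrite predeqE => -[a b]; split; move=> [i _ <-]; exists i.
apply: lee_nneseries => [i _ _|i _]; first exact: nneseries_ge0.
exact: (PG i).2.
Qed.

HB.instance Definition _ := isOuterMeasure.Build R (euclid R n) lebesgue_outer
  lebesgue_outer0 lebesgue_outer_ge0 le_lebesgue_outer
  lebesgue_outer_sigma_subadditive.

End lebesgue.

(* [euclid R n] carries the (complete) Lebesgue sigma-algebra, i.e. the
   Caratheodory-measurable sets of the Lebesgue outer measure, and not only the
   Borel one. *)
HB.instance Definition _ (R : realType) (n : nat) :=
  Measurable.copy (euclid R n) (caratheodory_type (@lebesgue_outer R n)).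

Definition lebesgue_Rd (R : realType) (n : nat) :
  set (euclid R n) -> \bar R := @lebesgue_outer R n.

HB.instance Definition _ (R : realType) (n : nat) :=
  isMeasure.Build _ (euclid R n) R (@lebesgue_Rd R n)
    (@caratheodory_measure0 R _ (@lebesgue_outer R n))
    (@caratheodory_measure_ge0 R _ (@lebesgue_outer R n))
    (@caratheodory_measure_sigma_additive R _ (@lebesgue_outer R n)).

Section function_spaces.
Context (R : realType) (n : nat).
Local Notation E := (euclid R n).
Local Notation mu := (@lebesgue_Rd R n).
Local Open Scope complex_scope.
Implicit Types (f g : E -> R[i]) (A : set E) (p : E -> \bar R) (q alpha : \bar R)
  (X : set (E -> R[i])) (N sigma : (E -> R[i]) -> \bar R).

(* The elements of L^0 are handled through representatives: a space of classes
   is a set of measurable functions, and relations between classes are stated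
   almost everywhere. *)
Definition L0 : set (E -> R[i]) :=
  [set f : E -> R[i] | measurable_fun [set: E] (fun x => complex.Re (f x)) /\
    measurable_fun [set: E] (fun x => complex.Im (f x))].

(* The order of R[i] is partial: 0 <= z holds iff z is real and nonnegative. *)
Definition L0_plus : set (E -> R[i]) :=
  [set f | L0 f /\ {ae mu, forall x, 0 <= f x}].

Definition restr f A : E -> R[i] := fun x => f x * \1_A x.

Definition variable_exponent p :=
  measurable_fun [set: E] p /\ forall x, (1 <= p x)%E.

(* t ^ s for t >= 0 and s in [1, +oo]; the last branch is never used *)
Definition epow (t : R) (s : \bar R) : \bar R :=
  match s with
  | s%:E => (t `^ s)%:E
  | +oo%E => if t <= 1 then 0%E else +oo%E
  | -oo%E => 0%E
  end.

Definition modular p f : \bar R :=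
  (\int[mu]_x epow (complex.Re `|f x|%R) (p x))%E.

Definition luxemburg p f : \bar R :=
  ereal_inf [set l%:E | l in
    [set l : R | 0 < l /\ (modular p (fun x => (l^-1)%:C * f x)%R <= 1)%E]].

Definition Lp p : set (E -> R[i]) := [set f | L0 f /\ (luxemburg p f < +oo)%E].

Definition Lp_loc p : set (E -> R[i]) :=
  [set f | L0 f /\ forall K, compact K -> Lp p (restr f K)].

Definition cube (r : R) (k : 'rV[int]_n.+1) : set E :=
  [set x | forall j,
     r * (k ord0 j)%:~R <= x ord0 j < r * ((k ord0 j)%:~R + 1)].

(* norm in l^q of a nonnegative family; the last branch is never used *)
Definition lq_norm (I : choiceType) q (a : I -> \bar R) : \bar R :=
  match q with
  | q%:E => ((\esum_(k in [set: I]) (a k `^ q)) `^ q^-1)%E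
  | +oo%E => ereal_sup (range a)
  | -oo%E => 0%E
  end.

Definition amalgam_norm p q f : \bar R :=
  lq_norm q (fun k => luxemburg p (restr f (cube 1 k))).

(* d / alpha for d = n.+1, with d / oo = 0 *)
Definition dim_div alpha : R :=
  if alpha is a%:E then n.+1%:R / a else 0.

Definition St alpha (rho : R) f : E -> R[i] :=
  fun x => (rho `^ (- dim_div alpha))%:C * f (rho^-1 *: x).

Definition fofana_norm p q alpha f : \bar R :=
  ereal_sup [set amalgam_norm p q (St alpha rho f) | rho in [set rho | 0 < rho]].

Definition fofana p q alpha : set (E -> R[i]) :=
  [set f | Lp_loc p f /\ (fofana_norm p q alpha f < +oo)%E].

(* fn_ae states that sigma is well defined on classes. *)
Record function_norm sigma : Prop := FunctionNorm {
  fn_ae : forall f g, L0_plus f -> L0_plus g ->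
    {ae mu, forall x, f x = g x} -> sigma f = sigma g ;
  fn_ge0 : forall f, L0_plus f -> (0 <= sigma f)%E ;
  fn_eq0 : forall f, L0_plus f ->
    (sigma f = 0%E <-> {ae mu, forall x, f x = 0}) ;
  fn_homogeneous : forall f (l : R), L0_plus f -> 0 <= l ->
    sigma (fun x => l%:C * f x) = (l%:E * sigma f)%E ;
  fn_triangle : forall f g, L0_plus f -> L0_plus g ->
    (sigma (fun x => f x + g x)%R <= sigma f + sigma g)%E ;
  fn_monotone : forall f g, L0_plus f -> L0_plus g ->
    {ae mu, forall x, f x <= g x} -> (sigma f <= sigma g)%E }.

Definition kothe_norm sigma f : \bar R := sigma (fun x => `|f x|).

Definition kothe_space sigma : set (E -> R[i]) :=
  [set f | L0 f /\ (kothe_norm sigma f < +oo)%E].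

Definition normed_kothe_space X N :=
  exists sigma, [/\ function_norm sigma, X = kothe_space sigma &
    forall f, X f -> N f = kothe_norm sigma f].

Definition norm_complete X N :=
  forall f_ : nat -> E -> R[i], (forall m, X (f_ m)) ->
  (forall e : R, 0 < e -> exists M : nat, forall k m : nat,
    (M <= k)%N -> (M <= m)%N -> (N (fun x => f_ k x - f_ m x)%R < e%:E)%E) ->
  exists2 f, X f & N (fun x => f_ m x - f x) @[m --> \oo] --> 0%E.

Definition banach_function_space X N :=
  normed_kothe_space X N /\ norm_complete X N.

(* 0 <= f_m increasing to f in L^0 *)
Definition increases_to (f_ : nat -> E -> R[i]) f :=
  [/\ forall m, {ae mu, forall x, 0 <= f_ m x},
      forall m, {ae mu, forall x, f_ m x <= f_ m.+1 x} &
      {ae mu, forall x,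
         complex.Re `|f_ m x - f x| @[m --> \oo] --> (0 : R)}].

Definition fatou_property X N :=
  forall (f_ : nat -> E -> R[i]) f, (forall m, X (f_ m)) -> L0 f ->
  increases_to f_ f -> (ereal_sup (range (fun m => N (f_ m))) < +oo)%E ->
  X f /\ N (f_ m) @[m --> \oo] --> N f.

End function_spaces.

(* Main.v *)
Require Import Defs.
From HB Require Import structures.
From mathcomp Require Import all_boot all_order all_algebra.
From mathcomp Require Import all_classical all_reals all_analysis.
From mathcomp Require Import measurable_realfun ring lra.

(** Every norm in sight depends on a complex function f only through |f|, so the
    argument takes place among nonnegative measurable real functions.  The
    relevant functionals are those that are monotone almost everywhere,
    positively homogeneous, subadditive, and lower semicontinuous along
    increasing sequences: the record [fatou_seminorm].

    This class has a base case and is closed under the operations that build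
    the Fofana norm.  The Luxemburg norm is the gauge of the modular
    h |-> \int h^p, and belongs to the class because t |-> t^s is convex and
    increasing for 1 <= s <= oo and because of monotone convergence
    ([fatou_seminorm_gauge]).  Membership survives multiplication by a weight and
    a nonsingular change of variables ([fatou_seminorm_comp]), the l^q norm of a
    family ([fatou_seminorm_lq]) and suprema ([fatou_seminorm_sup]).  The Fofana
    norm is the supremum over rho of the l^q norms of the Luxemburg norms of the
    pieces of the rho-dilate of f cut out by the unit cubes, so it is a Fatou
    seminorm ([fatou_seminorm_fofana]).  It is definite since the unit cubes of
    the term rho = 1 cover the space ([fofana_gauge_eq0]), and its finiteness
    forces local p-integrability since a compact set meets finitely many unit
    cubes ([fofana_loc]).

    For a definite Fatou seminorm nu the functions with nu |f| < oo always form a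
    Banach function space with the Fatou property.  The engine is
    [fs_fatou_dominated]: a bound on nu along an increasing sequence passes to
    every function below its supremum.  It makes the sum of the increments of a
    rapidly Cauchy subsequence finite almost everywhere ([fs_finite_ae]) and then
    bounds the distance from the limit to the subsequence, which is the
    Riesz-Fischer argument ([norm_complete_modulus]).

    The geometry of Lebesgue measure enters in two places: half-spaces cut boxes
    into boxes of the same total volume, so cubes and compact sets are
    Caratheodory measurable; and dilations multiply the outer measure by a
    constant, so they preserve measurability and null sets. *)

Set Implicit Arguments.
Unset Strict Implicit.
Unset Printing Implicit Defensive.
Import Order.TTheory GRing.Theory Num.Theory.
Import numFieldNormedType.Exports.
Local Open Scope classical_set_scope.
Local Open Scope ring_scope.

(** * Seminorms with the Fatou property *)

Section seminorm.
Context d (T : measurableType d) (R : realType) (mu : {measure set T -> \bar R}).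

Definition mnneg (h : T -> R) := measurable_fun [set: T] h /\ forall x, 0 <= h x.

(** [fs_leZ] asks only for one inequality: applied to l^-1 it yields the other.
    [fs_fatou] is a lower semicontinuity statement: with [fs_le] it says that nu
    commutes with increasing limits. *)
Record fatou_seminorm (nu : (T -> R) -> \bar R) : Prop := FatouSeminorm {
  fs_ge0 : forall h, (0 <= nu h)%E ;
  fs_le0 : (nu (cst 0%R) <= 0)%E ;
  fs_leZ : forall h (l : R), mnneg h -> 0 < l ->
    (nu (fun x => l * h x)%R <= l%:E * nu h)%E ;
  fs_leD : forall g h, mnneg g -> mnneg h ->
    (nu (fun x => g x + h x)%R <= nu g + nu h)%E ;
  fs_le : forall g h, mnneg g -> mnneg h ->
    {ae mu, forall x, g x <= h x} -> (nu g <= nu h)%E ;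
  fs_fatou : forall (h_ : nat -> T -> R) h c, (forall m, mnneg (h_ m)) ->
    mnneg h -> (forall x, nondecreasing_seq (h_^~ x)) ->
    (forall x, h_ ^~ x @ \oo --> h x) ->
    (forall m, nu (h_ m) <= c)%E -> (nu h <= c)%E }.

Lemma mnneg_cst0 : mnneg (cst 0).
Proof. by split. Qed.

Lemma mnnegM g h : mnneg g -> mnneg h -> mnneg (fun x => g x * h x).
Proof.
move=> [mg g0] [mh h0]; split; first exact: measurable_funM.
by move=> x; rewrite mulr_ge0.
Qed.

Lemma mnnegD g h : mnneg g -> mnneg h -> mnneg (fun x => g x + h x).
Proof.
move=> [mg g0] [mh h0]; split; first exact: measurable_funD.
by move=> x; rewrite addr_ge0.
Qed.

Lemma mnnegZ (l : R) h : 0 <= l -> mnneg h -> mnneg (fun x => l * h x).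
Proof. by move=> l0; apply: mnnegM; split. Qed.

Lemma mnneg_indic A : measurable A -> mnneg (\1_A).
Proof. by move=> mA; split=> [|x]; [exact: measurable_indic|rewrite indicE]. Qed.

Lemma mnneg_min g h : mnneg g -> mnneg h -> mnneg (fun x => Num.min (g x) (h x)).
Proof.
move=> [mg g0] [mh h0]; split; first exact: measurable_minr.
by move=> x; rewrite le_min g0 h0.
Qed.

Lemma mnneg_sum (h_ : nat -> T -> R) m :
  (forall k, mnneg (h_ k)) -> mnneg (fun x => \sum_(k < m) h_ k x).
Proof.
move=> hh; split; first by apply: measurable_sum => k; exact: (hh k).1.
by move=> x; apply: sumr_ge0 => k _; exact: (hh k).2.
Qed.

Section theory.
Variable nu : (T -> R) -> \bar R.
Hypothesis nuF : fatou_seminorm nu.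

Lemma fs0 : nu (cst 0) = 0%E.
Proof. by apply/eqP; rewrite eq_le (fs_ge0 nuF) (fs_le0 nuF). Qed.

Lemma fsZ h (l : R) : mnneg h -> 0 <= l ->
  nu (fun x => l * h x) = (l%:E * nu h)%E.
Proof.
move=> hh; rewrite le_eqVlt => /predU1P[<-|l0].
  by rewrite mul0e -[RHS]fs0; congr nu; apply/funext => x; rewrite mul0r.
apply/eqP; rewrite eq_le (fs_leZ nuF)//=.
have lh : mnneg (fun x => l * h x) by apply: mnnegZ => //; exact: ltW.
rewrite muleC -lee_pdivlMr// muleC.
have := fs_leZ nuF lh; have li0 : 0 < l^-1 by rewrite invr_gt0.
move=> /(_ _ li0); congr (nu _ <= _)%E.
by apply/funext => x; rewrite mulrA mulVf ?mul1r ?gt_eqF.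
Qed.

Lemma fs_sum_le (h_ : nat -> T -> R) m : (forall k, mnneg (h_ k)) ->
  (nu (fun x => \sum_(k < m) h_ k x)%R <= \sum_(k < m) nu (h_ k))%E.
Proof.
move=> hh; elim: m => [|m IH].
  rewrite big_ord0 -fs0 le_eqVlt; apply/orP; left; apply/eqP; congr nu.
  by apply/funext => x; rewrite big_ord0.
rewrite big_ord_recr/= (_ : (fun x => _) =
    fun x => \sum_(k < m) h_ k x + h_ m x); last first.
  by apply/funext => x; rewrite big_ord_recr.
rewrite (le_trans (fs_leD nuF (mnneg_sum _ hh) (hh _)))//.
by rewrite leeD2r.
Qed.

(** The functions min (g_m, h) increase to h wherever h is below the supremum
    of the g_m, so the Fatou axiom applies to them once the exceptional null set
    has been cut out. *)
Lemma fs_fatou_dominated (g_ : nat -> T -> R) h c : (forall m, mnneg (g_ m)) ->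
  mnneg h ->
  {ae mu, forall x, nondecreasing_seq (g_^~ x) /\
     ((h x)%:E <= ereal_sup (range (fun m => (g_ m x)%:E)))%E} ->
  (forall m, nu (g_ m) <= c)%E -> (nu h <= c)%E.
Proof.
move=> gg hh [B [mB muB0 Bsub]] gc.
have good x : ~ B x -> nondecreasing_seq (g_^~ x) /\
    ((h x)%:E <= ereal_sup (range (fun m => (g_ m x)%:E)))%E.
  by move=> nBx; apply: contrapT => P; apply/nBx/Bsub.
have aeB : {ae mu, forall x, ~ B x}.
  by exists B; split => // x /= /contrapT.
have iB : mnneg (\1_(~` B)) by apply: mnneg_indic; exact: measurableC.
pose f_ m x := \1_(~` B) x * Num.min (g_ m x) (h x).
pose f x := \1_(~` B) x * h x.
have ff m : mnneg (f_ m) by apply: mnnegM => //; exact: mnneg_min.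
have fm : mnneg f by exact: mnnegM.
apply: (@le_trans _ _ (nu f)).
  apply: (fs_le nuF) => //; apply: filterS aeB => x nBx.
  by rewrite /f indicE mem_set// mul1r.
apply: (fs_fatou nuF ff fm) => [x m k mk|x|m].
- rewrite /f_ indicE; have [Bx|nBx] := pselect (B x).
    by rewrite memNset ?mul0r//= => /(_ Bx).
  rewrite mem_set// !mul1r le_min !ge_min lexx orbT andbT.
  by rewrite (good _ nBx).1.
- rewrite /f_ /f indicE; have [Bx|nBx] := pselect (B x).
    rewrite memNset => [|/(_ Bx)//]; rewrite mul0r.
    by under eq_fun do rewrite mul0r; exact: cvg_cst.
  rewrite mem_set// mul1r; under eq_fun do rewrite mul1r.
  have [nd hs] := good _ nBx.
  apply/cvgrPdist_le => e e0.
  have /ereal_sup_gt : ((h x - e)%:E <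
      ereal_sup (range (fun m => (g_ m x)%:E)))%E.
    by apply: lt_le_trans hs; rewrite lte_fin ltrBlDr ltrDl.
  move=> [_ [k _ <-]]; rewrite lte_fin => /ltW hk; near=> m.
  have hm : h x - e <= g_ m x.
    by apply: le_trans hk _; apply: nd; near: m; exists k.
  rewrite ger0_norm ?subr_ge0 ?ge_min ?lexx ?orbT// lerBlDr -lerBlDl.
  by rewrite le_min hm lerBlDr lerDl ltW.
- apply: le_trans (gc m); apply: (fs_le nuF) => //.
  apply: filterS aeB => x nBx.
  by rewrite /f_ indicE mem_set// mul1r ge_min lexx.
Unshelve. all: by end_near. Qed.

(** On the set A where the g_m are unbounded, every multiple of the indicator
    of A lies below their supremum; hence j nu(1_A) <= c for all j, so
    nu(1_A) = 0 and A is null. *)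
Lemma fs_finite_ae (g_ : nat -> T -> R) (c : R) :
  (forall h, mnneg h -> nu h = 0%E -> {ae mu, forall x, h x = 0}) ->
  (forall m, mnneg (g_ m)) -> (forall x, nondecreasing_seq (g_^~ x)) ->
  (forall m, nu (g_ m) <= c%:E)%E ->
  {ae mu, forall x, (ereal_sup (range (fun m => (g_ m x)%:E)) < +oo)%E}.
Proof.
move=> def gg nd gc.
pose s x := ereal_sup (range (fun m => (g_ m x)%:E)).
have ms : measurable_fun [set: T] s.
  rewrite (_ : s = fun x => limn (fun m => (g_ m x)%:E)); last first.
    apply/funext => x; apply/esym/cvg_lim => //.
    apply: ereal_nondecreasing_cvgn => m k mk; rewrite lee_fin; exact: nd.
  apply: (@emeasurable_fun_cvg _ _ _ _ (fun m x => (g_ m x)%:E)).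
    by move=> m; apply/measurable_EFinP; exact: (gg m).1.
  move=> x _; apply: ereal_nondecreasing_is_cvgn => m k mk.
  by rewrite lee_fin; exact: nd.
pose A := [set x | s x = +oo%E].
have mA : measurable A.
  rewrite -[A]setTI (_ : A = s @^-1` [set +oo%E])//.
  exact: (ms measurableT).
have Ai : mnneg (\1_A) by exact: mnneg_indic.
(* On A the supremum of the g_m is infinite, so j times its indicator is
   dominated by them. *)
have jA (j : nat) : (j%:R%:E * nu (\1_A) <= c%:E)%E.
  rewrite -fsZ//; apply: (fs_fatou_dominated gg) => //.
    exact: mnnegZ.
  apply: aeW => x; split; first exact: nd.
  rewrite indicE; have [Ax|nAx] := pselect (A x).
    by rewrite -/(s x) (Ax : s x = +oo%E) leey.
  rewrite memNset// mulr0; apply: ereal_sup_ge; exists (g_ 0%N x)%:E.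
    by exists 0%N.
  by rewrite lee_fin (gg _).2.
have nuA0 : nu (\1_A) = 0%E.
  apply/eqP; rewrite eq_le (fs_ge0 nuF) andbT leNgt; apply/negP => nuA.
  have c0 : 0 <= c by have := jA 0%N; rewrite mul0e lee_fin.
  have nuAfin : nu (\1_A) \is a fin_num.
    rewrite ge0_fin_numE ?(fs_ge0 nuF)//; have := jA 1%N; rewrite mul1e.
    by move=> /le_lt_trans; apply; rewrite ltry.
  have := jA (Num.trunc (c / fine (nu (\1_A)))).+1.
  rewrite -(fineK nuAfin) -EFinM lee_fin leNgt -ltr_pdivrMr.
    by rewrite truncnS_gt.
  by rewrite fine_gt0// nuA ltey_eq nuAfin.
apply: filterS (def _ Ai nuA0) => x; rewrite indicE.
have [Ax|nAx] := pselect (A x).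
  by rewrite mem_set// => /eqP; rewrite oner_eq0.
by move=> _; rewrite ltey; apply/eqP.
Qed.

End theory.

Lemma fatou_seminorm_sup (I : Type) (J : set I) (nu_ : I -> (T -> R) -> \bar R) :
  J !=set0 -> (forall i, J i -> fatou_seminorm (nu_ i)) ->
  fatou_seminorm (fun h => ereal_sup [set nu_ i h | i in J]).
Proof.
move=> [i0 Ji0] nuF; split => [h||h l hh l0|g h gg hh|g h gg hh gh|].
- by apply: ereal_sup_ge; exists (nu_ i0 h); [exists i0|exact: fs_ge0 (nuF _ _) _].
- by apply: ge_ereal_sup => _ [i Ji <-]; exact: fs_le0 (nuF _ _).
- apply: ge_ereal_sup => _ [i Ji <-].
  rewrite (le_trans (fs_leZ (nuF _ Ji) hh l0))// lee_pmul2l//.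
  by apply: ereal_sup_ubound; exists i.
- apply: ge_ereal_sup => _ [i Ji <-].
  rewrite (le_trans (fs_leD (nuF _ Ji) gg hh))// leeD//;
    by apply: ereal_sup_ubound; exists i.
- apply: ge_ereal_sup => _ [i Ji <-].
  rewrite (le_trans (fs_le (nuF _ Ji) gg hh gh))//.
  by apply: ereal_sup_ubound; exists i.
- move=> h_ h c hh_ hh nd cv hc; apply: ge_ereal_sup => _ [i Ji <-].
  apply: (fs_fatou (nuF _ Ji) hh_ hh nd cv) => m; apply: le_trans (hc m).
  by apply: ereal_sup_ubound; exists i.
Qed.

(** The condition on null sets is what turns an almost everywhere inequality
    g <= h into an almost everywhere inequality after composition with phi. *)
Lemma fatou_seminorm_comp (w : T -> R) (phi : T -> T) nu :
  mnneg w -> measurable_fun [set: T] phi ->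
  (forall A, measurable A -> mu A = 0%E -> mu (phi @^-1` A) = 0%E) ->
  fatou_seminorm nu -> fatou_seminorm (fun h => nu (fun x => w x * h (phi x))).
Proof.
move=> ww mphi phi0 nuF.
have comp h : mnneg h -> mnneg (fun x => w x * h (phi x)).
  move=> [mh h0]; apply: mnnegM => //; split => //.
  exact: measurableT_comp mh mphi.
split => [h||h l hh l0|g h gg hh|g h gg hh gh|h_ h c hh_ hh nd cv hc].
- exact: fs_ge0 nuF _.
- apply: le_trans (fs_le0 nuF); rewrite le_eqVlt; apply/orP; left.
  by apply/eqP; congr nu; apply/funext => x; rewrite mulr0.
- apply: le_trans (fs_leZ nuF (comp _ hh) l0).
  rewrite le_eqVlt; apply/orP; left; apply/eqP; congr nu.
  by apply/funext => x; rewrite mulrCA.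
- apply: le_trans (fs_leD nuF (comp _ gg) (comp _ hh)).
  rewrite le_eqVlt; apply/orP; left; apply/eqP; congr nu.
  by apply/funext => x; rewrite mulrDr.
- apply: (fs_le nuF); [exact: comp..|].
  case: gh => B [mB muB Bsub]; exists (phi @^-1` B); split.
  + by rewrite -[X in measurable X]setTI; exact: mphi.
  + exact: phi0.
  + move=> x /= H; apply: Bsub => /= gh; apply: H.
    by rewrite ler_wpM2l//; exact: ww.2.
- apply: (fs_fatou nuF) hc => [m||x m k mk|x]; [exact: comp..| |].
  + by rewrite ler_wpM2l//; [exact: ww.2|exact: nd].
  + by apply: cvgMr; exact: cv.
Qed.

End seminorm.

(** * Convexity of powers, with exponents up to infinity *)

Section powers.
Context (R : realType).

Lemma powR_le_inv (a c r : R) : 0 < r -> 0 <= a -> a `^ r <= c -> a <= c `^ r^-1.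
Proof.
move=> r0 a0 ac; rewrite -[leLHS](powRr1 a0) -(@mulfV _ r) ?gt_eqF// powRrM.
by rewrite ge0_ler_powR ?nnegrE ?powR_ge0 ?invr_ge0 ?(ltW r0)// (le_trans _ ac)
  ?powR_ge0.
Qed.

Lemma poweR_le_inv (a c : \bar R) r : 0 < r -> (0 <= a)%E ->
  (a `^ r <= c -> a <= c `^ r^-1)%E.
Proof.
move=> r0 a0 ac; rewrite -[leLHS](poweRe1 a0) -(@mulfV _ r) ?gt_eqF// poweRrM.
rewrite gt0_ler_poweR ?invr_ge0 ?(ltW r0)// in_itv/= leey andbT ?poweR_ge0//.
by rewrite (le_trans _ ac) ?poweR_ge0.
Qed.

(** Convexity of the power at the weights s / (s + t) and t / (s + t).  This is
    the form that gives the triangle inequality of a gauge: if s and t are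
    admissible for a and b, then s + t is admissible for a + b. *)
Lemma powR_weighted_convex (r s t a b : R) : 1 <= r -> 0 < s -> 0 < t ->
  0 <= a -> 0 <= b ->
  ((s + t)^-1 * (a + b)) `^ r <=
    s / (s + t) * (s^-1 * a) `^ r + t / (s + t) * (t^-1 * b) `^ r.
Proof.
move=> r1 s0 t0 a0 b0.
have st0 : 0 < s + t by rewrite addr_gt0.
have w0 : 0 <= s / (s + t) by rewrite divr_ge0 ?ltW.
have w1 : s / (s + t) <= 1 by rewrite ler_pdivrMr// mul1r lerDl ltW.
have := @convex_powR R r r1 (Itv01 w0 w1) (s^-1 * a) (t^-1 * b).
have sa : 0 <= s^-1 * a by rewrite mulr_ge0 ?invr_ge0 ?(ltW s0).
have tb : 0 <= t^-1 * b by rewrite mulr_ge0 ?invr_ge0 ?(ltW t0).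
rewrite !inE/= !in_itv/= !andbT sa tb => /(_ isT isT).
rewrite convRE [X in X `^ _ <= _ -> _]convRE/= /unstable.onem.
have -> : 1 - s / (s + t) = t / (s + t).
  by field; rewrite gt_eqF.
suff -> : (s + t)^-1 * (a + b) =
    s / (s + t) * (s^-1 * a) + t / (s + t) * (t^-1 * b) by [].
by field; rewrite !gt_eqF.
Qed.

Lemma poweR_weighted_convex (r s t : R) (a b : \bar R) : 1 <= r ->
  0 < s -> 0 < t -> (0 <= a)%E -> (0 <= b)%E ->
  (((s + t)^-1%:E * (a + b)) `^ r <=
    (s / (s + t))%:E * (s^-1%:E * a) `^ r +
    (t / (s + t))%:E * (t^-1%:E * b) `^ r)%E.
Proof.
move=> r1 s0 t0.
have r0 : 0 < r by rewrite (lt_le_trans _ r1).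
have st0 : 0 < s + t by rewrite addr_gt0.
case: a b => [a| |] [b| |] a0 b0 //; last first.
- rewrite !gt0_muley ?lte_fin ?invr_gt0// !poweRyr ?gt_eqF//.
  by rewrite !gt0_muley ?lte_fin ?divr_gt0// leey.
- rewrite [(s^-1%:E * _)%E]gt0_muley ?lte_fin ?invr_gt0// poweRyr ?gt_eqF//.
  rewrite [((s / _)%:E * _)%E]gt0_muley ?lte_fin ?divr_gt0//.
  by rewrite addye ?leey// -?EFinM -?poweR_EFin.
- rewrite [(t^-1%:E * _)%E]gt0_muley ?lte_fin ?invr_gt0// poweRyr ?gt_eqF//.
  rewrite [((t / _)%:E * _)%E]gt0_muley ?lte_fin ?divr_gt0//.
  by rewrite addey ?leey// -?EFinM -?poweR_EFin.
- by rewrite -!EFinM !poweR_EFin lee_fin powR_weighted_convex.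
Qed.

Lemma epow_ge0 (t : R) s : (0 <= epow t s)%E.
Proof. by case: s => [s| |]//=; [rewrite lee_fin powR_ge0|case: ifP]. Qed.

Lemma le_epow (s : \bar R) : (1 <= s)%E ->
  {in Num.nneg &, {homo (fun a : R => epow a s) : a b / a <= b >-> (a <= b)%E}}.
Proof.
case: s => [s| |]//= s1 a b; rewrite !nnegrE => a0 b0 ab.
- by rewrite lee_fin ge0_ler_powR ?nnegrE//; exact: (@le_trans _ _ 1).
- case: ifPn => [_|]; first by case: ifP.
  by rewrite -ltNge => /lt_le_trans/(_ ab); rewrite ltNge => /negbTE ->.
Qed.

Lemma epow_convex (e : \bar R) (s t a b : R) : (1 <= e)%E ->
  0 < s -> 0 < t -> 0 <= a -> 0 <= b ->
  (epow ((s + t)^-1 * (a + b)) e <=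
    (s / (s + t))%:E * epow (s^-1 * a) e +
    (t / (s + t))%:E * epow (t^-1 * b) e)%E.
Proof.
case: e => [r| |]//= r1 s0 t0 a0 b0.
  by rewrite -!EFinM lee_fin powR_weighted_convex.
have st0 : 0 < s + t by rewrite addr_gt0.
rewrite [in X in (_ <= _ * X + _)%E]mulrC ler_pdivrMr// mul1r.
rewrite [in X in (_ <= _ + _ * X)%E]mulrC ler_pdivrMr// mul1r.
rewrite [in X in (X <= _)%E]mulrC ler_pdivrMr// mul1r.
have ws : (0 < (s / (s + t))%:E)%E by rewrite lte_fin divr_gt0.
have wt : (0 < (t / (s + t))%:E)%E by rewrite lte_fin divr_gt0.
case: (leP a s) => sa; case: (leP b t) => tb.
- by rewrite lerD// !mule0 adde0.
- by rewrite !mule0 gt0_muley// add0e leey.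
- by rewrite !mule0 gt0_muley// adde0 leey.
- by rewrite !gt0_muley// leey.
Qed.

(** The limit of the increasing values is their supremum S, and a_m^r <= S gives
    a_m <= S^(1/r), a closed condition that passes to the limit a; for an
    infinite exponent the condition is a_m <= 1. *)
Lemma epow_fatou (e : \bar R) (a_ : nat -> R) a : (1 <= e)%E ->
  (forall m, 0 <= a_ m) -> nondecreasing_seq a_ -> a_ @ \oo --> a ->
  epow (a_ m) e @[m --> \oo] --> epow a e.
Proof.
move=> e1 a0 nd cv.
have am m : a_ m <= a.
  rewrite -(cvg_lim _ cv)//; apply: nondecreasing_cvgn_le => //.
  by apply/cvg_ex; exists a.
have a00 : 0 <= a by exact: le_trans (a0 0%N) (am 0%N).
have lea c : (forall m, a_ m <= c) -> a <= c.
  move=> ac; rewrite -(cvg_lim _ cv)//; apply: limr_le.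
    by apply/cvg_ex; exists a.
  exact: nearW.
rewrite (_ : epow a e = ereal_sup (range (fun m => epow (a_ m) e))); last first.
  apply/eqP; rewrite eq_le; apply/andP; split; last first.
    by apply: ge_ereal_sup => _ [m _ <-]; apply: le_epow; rewrite ?nnegrE.
  set S := ereal_sup _.
  have eS m : (epow (a_ m) e <= S)%E by apply: ereal_sup_ubound; exists m.
  have S0 : (0 <= S)%E by rewrite (le_trans _ (eS 0%N)) ?epow_ge0.
  move: S S0 eS => [S| |]// S0 eS; last by rewrite leey.
  move: e1 eS; case: e => [r| |]//= r1 eS.
    have r0 : 0 < r by exact: (@lt_le_trans _ _ 1).
    have : a <= S `^ r^-1.
      by apply: lea => m; apply: powR_le_inv => //; rewrite -lee_fin.
    move=> aS; have -> : S = (S `^ r^-1) `^ r.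
      by rewrite -powRrM mulVf ?gt_eqF// powRr1// -lee_fin.
    by rewrite lee_fin ge0_ler_powR ?nnegrE ?powR_ge0// ltW.
  rewrite lea// => m; have := eS m; case: ifP => //.
by apply: ereal_nondecreasing_cvgn => m k mk; apply: le_epow; rewrite ?nnegrE// nd.
Qed.

(** Base and exponent both vary, so the power is rewritten as exp (p ln h) away
    from the measurable sets where p is infinite or h vanishes. *)
Lemma measurable_fun_epow d (T : measurableType d) (h : T -> R) (p : T -> \bar R) :
  measurable_fun [set: T] h -> measurable_fun [set: T] p ->
  (forall x, (1 <= p x)%E) ->
  measurable_fun [set: T] (fun x => epow (h x) (p x)).
Proof.
move=> mh mp p1.
rewrite (_ : (fun x => _) = fun x => if p x == +oo%E then
    (if h x <= 1 then 0%E else +oo%E)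
  else (if h x == 0 then ((fine (p x) == 0)%:R)%:E
    else (expR (fine (p x) * ln (h x)))%:E)); last first.
  apply/funext => x; have := p1 x; case: (p x) => [r| |]//= _.
  by rewrite /powR; case: ifP.
have mfp : measurable_fun [set: T] (fun x => fine (p x)).
  by apply: measurableT_comp mp.
apply: measurable_fun_ifT.
- exact: measurable_fun_eqe.
- by apply: measurable_fun_ifT => //; exact: measurable_fun_ler.
- apply: measurable_fun_ifT.
  + exact: measurable_fun_eqr.
  + apply/measurable_EFinP.
    rewrite (_ : (fun x => _) = fun x => if fine (p x) == 0 then 1 else 0); last first.
      by apply/funext => x; case: ifP.
    by apply: measurable_fun_ifT => //; exact: measurable_fun_eqr.
  + apply/measurable_EFinP; apply: measurableT_comp => //.
    by apply: measurable_funM => //; exact: measurableT_comp mh.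
Qed.

End powers.

(** * The Luxemburg gauge of a variable exponent *)

Section luxemburg_gauge.
Context d (T : measurableType d) (R : realType) (mu : {measure set T -> \bar R}).
Variable p : T -> \bar R.
Hypotheses (mp : measurable_fun [set: T] p) (p1 : forall x, (1 <= p x)%E).

Definition gauge_modular (h : T -> R) : \bar R :=
  (\int[mu]_x epow (h x) (p x))%E.

(** The Luxemburg norm over an arbitrary measure space. *)
Definition gauge (h : T -> R) : \bar R :=
  ereal_inf [set l%:E | l in
    [set l : R | 0 < l /\ (gauge_modular (fun x => (l^-1 * h x)%R) <= 1)%E]].

Lemma measurable_epow_mnneg h : mnneg h ->
  measurable_fun [set: T] (fun x => epow (h x) (p x)).
Proof. by move=> [mh _]; exact: measurable_fun_epow. Qed.

Lemma le_gauge_modular g h : mnneg g -> mnneg h ->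
  {ae mu, forall x, g x <= h x} -> (gauge_modular g <= gauge_modular h)%E.
Proof.
move=> gg hh gh; apply: ae_ge0_le_integral => //.
- by move=> x _; exact: epow_ge0.
- exact: measurable_epow_mnneg.
- by move=> x _; exact: epow_ge0.
- exact: measurable_epow_mnneg.
- apply: filterS gh => x gh _; apply: le_epow => //; rewrite nnegrE.
    exact: gg.2.
  exact: hh.2.
Qed.

Lemma gauge_lt h c : mnneg h -> (gauge h < c%:E)%E ->
  0 < c /\ (gauge_modular (fun x => c^-1 * h x)%R <= 1)%E.
Proof.
move=> hh /ereal_inf_lt[_ [l [l0 hl] <-]]; rewrite lte_fin => lc.
have c0 : 0 < c by exact: lt_trans lc.
split=> //; apply: le_trans hl; apply: le_gauge_modular.
- by apply: mnnegZ => //; rewrite invr_ge0 ltW.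
- by apply: mnnegZ => //; rewrite invr_ge0 ltW.
- apply: aeW => x; rewrite ler_wpM2r ?hh.2// lef_pV2 ?posrE//; exact: ltW.
Qed.

Lemma gauge_le h c : 0 < c -> (gauge_modular (fun x => c^-1 * h x)%R <= 1)%E ->
  (gauge h <= c%:E)%E.
Proof. by move=> c0 hc; apply: ereal_inf_lbound; exists c. Qed.

Lemma gauge_ge0 h : (0 <= gauge h)%E.
Proof.
by apply: le_ereal_inf_tmp => _ [l [l0 _] <-]; rewrite lee_fin ltW.
Qed.

Lemma epow0r (s : \bar R) : (1 <= s)%E -> epow (0 : R) s = 0%E.
Proof.
case: s => [r| |]//= r1; last by rewrite ler01.
by rewrite powR0// gt_eqF//; exact: (@lt_le_trans _ _ 1).
Qed.

(** Subadditivity comes from the convexity inequality integrated against mu, at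
    admissible s and t slightly above the two gauges; the Fatou axiom from
    monotone convergence of the modulars at every level above c. *)
Lemma fatou_seminorm_gauge : fatou_seminorm mu gauge.
Proof.
split => [||h l hh l0|g h gg hh|g h gg hh gh|h_ h c hh_ hh nd cv hc].
- exact: gauge_ge0.
- apply/lee_addgt0Pr => e e0; rewrite add0e; apply: gauge_le => //.
  rewrite /gauge_modular (_ : (fun x => _) = cst 0%E) ?integral0//.
  by apply/funext => x; rewrite mulr0 epow0r.
- rewrite muleC -lee_pdivrMr//; apply: le_ereal_inf_tmp => _ [a [a0 ha] <-].
  rewrite lee_pdivrMr// -EFinM; apply: gauge_le; first exact: mulr_gt0.
  rewrite (_ : (fun x => _) = fun x => a^-1 * h x)//.
  by apply/funext => x; field; rewrite !gt_eqF.
- have [->|goo] := eqVneq (gauge g) +oo%E.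
    by rewrite addye ?leey// gt_eqF// (lt_le_trans _ (gauge_ge0 _))// ltNy0.
  have [->|hoo] := eqVneq (gauge h) +oo%E.
    by rewrite addey ?leey// gt_eqF// (lt_le_trans _ (gauge_ge0 _))// ltNy0.
  have gfin : gauge g \is a fin_num by rewrite ge0_fin_numE ?gauge_ge0// ltey.
  have hfin : gauge h \is a fin_num by rewrite ge0_fin_numE ?gauge_ge0// ltey.
  apply/lee_addgt0Pr => e e0.
  have e20 : 0 < e / 2 by rewrite divr_gt0.
  have [s0 gs] : 0 < fine (gauge g) + e / 2 /\ (gauge_modular (fun x =>
      (fine (gauge g) + e / 2)^-1 * g x)%R <= 1)%E.
    by apply: gauge_lt => //; rewrite EFinD fineK// lteDl.
  have [t0 ht] : 0 < fine (gauge h) + e / 2 /\ (gauge_modular (fun x =>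
      (fine (gauge h) + e / 2)^-1 * h x)%R <= 1)%E.
    by apply: gauge_lt => //; rewrite EFinD fineK// lteDl.
  set s := fine (gauge g) + e / 2 in s0 gs.
  set t := fine (gauge h) + e / 2 in t0 ht.
  rewrite (_ : (_ + e%:E)%E = (s + t)%:E); last first.
    rewrite -(fineK gfin) -(fineK hfin) -!EFinD /s /t.
    by congr EFin; rewrite [in LHS](splitr e) addrACA.
  clearbody s t.
  have st0 : 0 < s + t by rewrite addr_gt0.
  apply: gauge_le => //.
  have sg : mnneg (fun x => s^-1 * g x).
    by apply: mnnegZ => //; rewrite invr_ge0 ltW.
  have th : mnneg (fun x => t^-1 * h x).
    by apply: mnnegZ => //; rewrite invr_ge0 ltW.
  have ws : 0 <= s / (s + t) by rewrite divr_ge0 ?ltW.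
  have wt : 0 <= t / (s + t) by rewrite divr_ge0 ?ltW.
  apply: (@le_trans _ _ (\int[mu]_x ((s / (s + t))%:E * epow (s^-1 * g x) (p x) +
      (t / (s + t))%:E * epow (t^-1 * h x) (p x)))%E).
    apply: ge0_le_integral => //.
    + by move=> x _; exact: epow_ge0.
    + apply: measurable_epow_mnneg; apply: mnnegZ; first by rewrite invr_ge0 ltW.
      exact: mnnegD.
    + apply: emeasurable_funD; apply: measurable_funeM;
        exact: measurable_epow_mnneg.
    + move=> x _; apply: epow_convex => //; first exact: gg.2.
      exact: hh.2.
  rewrite ge0_integralD//; last 4 first.
  + by move=> x _; rewrite mule_ge0// epow_ge0.
  + by apply: measurable_funeM; exact: measurable_epow_mnneg.
  + by move=> x _; rewrite mule_ge0// epow_ge0.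
  + by apply: measurable_funeM; exact: measurable_epow_mnneg.
  rewrite !ge0_integralZl_EFin//; last 4 first.
  + by move=> x _; exact: epow_ge0.
  + exact: measurable_epow_mnneg.
  + by move=> x _; exact: epow_ge0.
  + exact: measurable_epow_mnneg.
  apply: (@le_trans _ _ ((s / (s + t))%:E * 1 + (t / (s + t))%:E * 1)%E).
    by rewrite leeD// lee_wpmul2l.
  by rewrite !mule1 -EFinD -mulrDl mulfV ?gt_eqF.
- apply: le_ereal_inf_tmp => _ [l [l0 hl] <-]; apply: gauge_le => //.
  have li0 : 0 <= l^-1 by rewrite invr_ge0 ltW.
  apply: le_trans hl; apply: le_gauge_modular; try exact: mnnegZ.
  by apply: filterS gh => x gh; rewrite ler_wpM2l.
- case: c hc => [c| |] hc; last 2 first.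
  + by rewrite leey.
  + by have := le_trans (gauge_ge0 _) (hc 0%N).
  apply/lee_addgt0Pr => e e0; rewrite -EFinD.
  have hce m : 0 < c + e /\
      (gauge_modular (fun x => (c + e)^-1 * h_ m x)%R <= 1)%E.
    apply: gauge_lt => //; apply: le_lt_trans (hc m) _.
    by rewrite EFinD lteDl.
  have c0 := (hce 0%N).1; apply: gauge_le => //.
  have ci0 : 0 <= (c + e)^-1 by rewrite invr_ge0 ltW.
  have mh m : mnneg (fun x => (c + e)^-1 * h_ m x) by exact: mnnegZ.
  have ndh x : nondecreasing_seq (fun m => (c + e)^-1 * h_ m x).
    by move=> m k mk; rewrite ler_wpM2l// nd.
  rewrite /gauge_modular (_ : (fun x => _) =
      fun x => limn (fun m => epow ((c + e)^-1 * h_ m x) (p x))); last first.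
    apply/funext => x; apply/esym/cvg_lim => //.
    apply: epow_fatou => //; first by move=> m; exact: (mh m).2.
    by apply: cvgMr; exact: cv.
  rewrite monotone_convergence//; last 3 first.
  + by move=> m; exact: measurable_epow_mnneg.
  + by move=> m x _; exact: epow_ge0.
  + move=> x _ m k mk; apply: le_epow; rewrite ?nnegrE//; last exact: ndh.
      exact: (mh m).2.
    exact: (mh k).2.
  apply: lime_le; last by apply: nearW => m; exact: (hce m).2.
  apply: ereal_nondecreasing_is_cvgn => m k mk; apply: le_gauge_modular => //.
  by apply: aeW => x; exact: ndh.
Qed.

(** Since s >= 1, a factor k >= 1 is magnified by the power.  This is how an upper
    bound valid for all multiples of h forces the modular to vanish. *)
Lemma le_mul_epow (k t : R) (s : \bar R) : (1 <= s)%E -> 1 <= k -> 0 <= t ->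
  (k%:E * epow t s <= epow (k * t) s)%E.
Proof.
move=> + k1 t0; have k0 : 0 < k by exact: lt_le_trans k1.
case: s => [r| |]//= r1.
  rewrite -EFinM lee_fin powRM ?(ltW k0)// ler_wpM2r ?powR_ge0//.
  by rewrite -[leLHS](powRr1 (ltW k0)) ler_powR.
case: (leP t 1) => t1; first by rewrite mule0; case: ifP.
rewrite (_ : (k * t <= 1) = false) ?leey//; apply/negbTE.
by rewrite -ltNge (lt_le_trans t1)// ler_peMl.
Qed.

(** When the gauge vanishes, the modular of every multiple of h is at most 1, and
    j times the modular of k h is at most the modular of j k h; so all these
    modulars are zero.  All integer multiples k are needed at points where p is
    infinite, where a zero value of the power only says that k h <= 1. *)
Lemma gauge_eq0 h : mnneg h -> gauge h = 0%E -> {ae mu, forall x, h x = 0}.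
Proof.
move=> hh h0.
have mod1 k : 0 < k -> (gauge_modular (fun x => k * h x)%R <= 1)%E.
  move=> k0; have := @gauge_lt h k^-1 hh; rewrite h0 lte_fin invr_gt0 invrK.
  by move=> /(_ k0)[].
have mkh k : 0 < k -> mnneg (fun x => k * h x).
  by move=> k0; apply: mnnegZ => //; exact: ltW.
have mod0 k : 0 < k -> gauge_modular (fun x => k * h x) = 0%E.
  move=> k0; set I := gauge_modular _.
  have I0 : (0 <= I)%E by apply: integral_ge0 => x _; exact: epow_ge0.
  have jI j : 1 <= j -> (j%:E * I <= 1)%E.
    move=> j1; have j0 : 0 < j by exact: lt_le_trans j1.
    rewrite -ge0_integralZl_EFin//; last 3 first.
    - by move=> x _; exact: epow_ge0.
    - exact/measurable_epow_mnneg/mkh.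
    - exact: ltW.
    apply: le_trans (mod1 (j * k) (mulr_gt0 j0 k0)).
    apply: ge0_le_integral => //.
    - by move=> x _; rewrite mule_ge0 ?epow_ge0// lee_fin ltW.
    - by apply: measurable_funeM; exact/measurable_epow_mnneg/mkh.
    - exact/measurable_epow_mnneg/mkh/mulr_gt0.
    - move=> x _; rewrite -mulrA le_mul_epow// mulr_ge0 ?(ltW k0)//.
      exact: hh.2.
  have Ifin : I \is a fin_num.
    rewrite ge0_fin_numE//; have := jI 1 (lexx _); rewrite mul1e.
    by move=> /le_lt_trans; apply; rewrite ltry.
  apply/eqP; rewrite eq_le I0 andbT leNgt; apply/negP => Ipos.
  have I00 : 0 < fine I by rewrite fine_gt0// Ipos ltey_eq Ifin.
  have := jI (1 + 1 / fine I); rewrite lerDl divr_ge0 ?(ltW I00)// => /(_ isT).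
  rewrite -(fineK Ifin) -EFinM lee_fin mulrDl mul1r mul1r mulVf ?gt_eqF//.
  by rewrite gerDr leNgt I00.
have epow0 k : {ae mu, forall x, epow (k.+1%:R * h x) (p x) = 0%E}.
  have /ae_eq_integral_abs : measurable_fun [set: T]
      (fun x => epow (k.+1%:R * h x) (p x)) by exact/measurable_epow_mnneg/mkh.
  move=> /(_ mu measurableT)[+ _].
  under eq_integral do rewrite gee0_abs ?epow_ge0//.
  move=> /(_ (mod0 _ (ltr0Sn _ _))).
  by apply: filterS => x /(_ I).
apply: filterS (ae_foralln epow0) => x hx.
have := hh.2 x; rewrite le_eqVlt => /predU1P[//|hx0].
have := p1 x; move: hx; case: (p x) => [r| |]//= hx r1.
  have /eqP := hx 0%N; rewrite eqe => /eqP/powR_eq0_eq0; rewrite mul1r => ->//.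
have := hx (Num.trunc (h x)^-1); case: ifPn => // + _.
by rewrite -ler_pdivlMr// leNgt mul1r truncnS_gt.
Qed.

End luxemburg_gauge.

(** * Sequence norms of families of seminorms *)

Section lq_seminorm.
Context d (T : measurableType d) (R : realType) (mu : {measure set T -> \bar R}).
Context (I : choiceType).
Implicit Types (a b : I -> \bar R).

Lemma esumZl_le (k : R) a : 0 < k -> (forall i, 0 <= a i)%E ->
  (\esum_(i in [set: I]) (k%:E * a i) <= k%:E * \esum_(i in [set: I]) a i)%E.
Proof.
move=> k0 a0; apply: ge_ereal_sup => _ [F FI <-].
rewrite -ge0_mule_fsumr// lee_pmul2l//.
by apply: ereal_sup_ubound; exists F.
Qed.

Lemma lq_norm_leP (q : R) a (c : R) : 1 <= q -> 0 <= c -> (forall i, 0 <= a i)%E ->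
  (lq_norm q%:E a <= c%:E)%E <-> (\esum_(i in [set: I]) a i `^ q <= (c `^ q)%:E)%E.
Proof.
move=> q1 c0 a0; have q0 : 0 < q by exact: lt_le_trans q1.
have S0 : (0 <= \esum_(i in [set: I]) a i `^ q)%E.
  by apply: esum_ge0 => i _; exact: poweR_ge0.
rewrite /lq_norm; split => H.
  rewrite -[leLHS](poweRe1 S0) -(@mulVf _ q) ?gt_eqF// poweRrM -poweR_EFin.
  by rewrite gt0_ler_poweR ?(ltW q0)// in_itv/= ?poweR_ge0 ?leey// lee_fin c0.
have -> : c%:E = ((c `^ q)%:E `^ q^-1)%E.
  by rewrite poweR_EFin -powRrM mulfV ?gt_eqF// powRr1.
rewrite gt0_ler_poweR ?invr_ge0 ?(ltW q0)// in_itv/= ?leey ?andbT//.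
by rewrite lee_fin powR_ge0.
Qed.

Lemma le_lq_norm (q : R) a b : 0 < q ->
  (forall i, 0 <= a i)%E -> (forall i, a i <= b i)%E ->
  (lq_norm q%:E a <= lq_norm q%:E b)%E.
Proof.
move=> q0 a0 ab; have b0 i : (0 <= b i)%E by exact: le_trans (a0 i) (ab i).
rewrite /lq_norm gt0_ler_poweR ?invr_ge0 ?(ltW q0)// ?in_itv/= ?leey ?andbT.
- by apply: esum_ge0 => i _; exact: poweR_ge0.
- by apply: esum_ge0 => i _; exact: poweR_ge0.
- by apply: le_esum => i _; rewrite gt0_ler_poweR ?(ltW q0)// in_itv/= ?leey ?andbT.
Qed.

(** Minkowski's inequality, obtained like the triangle inequality of a gauge: the
    l^q norm is at most r exactly when the q-sum of the family divided by r is at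
    most 1, and the power is convex. *)
Lemma lq_norm_leD (q : R) a b : 1 <= q ->
  (forall i, 0 <= a i)%E -> (forall i, 0 <= b i)%E ->
  (lq_norm q%:E (fun i => a i + b i) <= lq_norm q%:E a + lq_norm q%:E b)%E.
Proof.
move=> q1 a0 b0; have q0 : 0 < q by exact: lt_le_trans q1.
have nge0 (c : I -> \bar R) : (0 <= lq_norm q%:E c)%E by exact: poweR_ge0.
have [->|aoo] := eqVneq (lq_norm q%:E a) +oo%E.
  by rewrite addye ?leey// gt_eqF// (lt_le_trans _ (nge0 _))// ltNy0.
have [->|boo] := eqVneq (lq_norm q%:E b) +oo%E.
  by rewrite addey ?leey// gt_eqF// (lt_le_trans _ (nge0 _))// ltNy0.
have afin : lq_norm q%:E a \is a fin_num by rewrite ge0_fin_numE ?nge0// ltey.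
have bfin : lq_norm q%:E b \is a fin_num by rewrite ge0_fin_numE ?nge0// ltey.
apply/lee_addgt0Pr => e e0.
have e20 : 0 < e / 2 by rewrite divr_gt0.
set s := fine (lq_norm q%:E a) + e / 2; set t := fine (lq_norm q%:E b) + e / 2.
rewrite (_ : (_ + e%:E)%E = (s + t)%:E); last first.
  rewrite -(fineK afin) -(fineK bfin) -!EFinD /s /t.
  by congr EFin; rewrite [in LHS](splitr e) addrACA.
have s0 : 0 < s by rewrite ltr_wpDl// fine_ge0.
have t0 : 0 < t by rewrite ltr_wpDl// fine_ge0.
have st0 : 0 < s + t by rewrite addr_gt0.
have unit (c : I -> \bar R) (r : R) : 0 < r -> (forall i, 0 <= c i)%E ->
    (lq_norm q%:E c <= r%:E)%E ->
    (\esum_(i in [set: I]) (r^-1%:E * c i) `^ q <= 1)%E.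
  move=> r0 c0 /(lq_norm_leP q1 (ltW r0) c0) H.
  rewrite (eq_esum (b := fun i => ((r^-1 `^ q)%:E * c i `^ q)%E)); last first.
    by move=> i _; rewrite poweRM// lee_fin invr_ge0 ltW.
  apply: le_trans (esumZl_le _ _) _.
  - by rewrite powR_gt0// invr_gt0.
  - by move=> i; exact: poweR_ge0.
  apply: (@le_trans _ _ ((r^-1 `^ q)%:E * (r `^ q)%:E)%E).
    by rewrite lee_wpmul2l// lee_fin powR_ge0.
  by rewrite -EFinM -powRM ?invr_ge0 ?(ltW r0)// mulVf ?gt_eqF// powR1.
have ua : (\esum_(i in [set: I]) (s^-1%:E * a i) `^ q <= 1)%E.
  by apply: unit => //; rewrite /s EFinD fineK// leeDl// lee_fin ltW.
have ub : (\esum_(i in [set: I]) (t^-1%:E * b i) `^ q <= 1)%E.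
  by apply: unit => //; rewrite /t EFinD fineK// leeDl// lee_fin ltW.
have ab0 i : (0 <= a i + b i)%E by rewrite adde_ge0.
apply/lq_norm_leP => //; first exact: ltW.
rewrite (eq_esum (b := fun i => (((s + t) `^ q)%:E *
    ((s + t)^-1%:E * (a i + b i)) `^ q)%E)); last first.
  move=> i _; rewrite poweRM ?lee_fin ?invr_ge0 ?(ltW st0)//.
  by rewrite muleA -EFinM -powRM ?invr_ge0 ?(ltW st0)// mulfV ?gt_eqF// powR1 mul1e.
apply: le_trans (esumZl_le _ _) _.
- by rewrite powR_gt0.
- by move=> i; exact: poweR_ge0.
rewrite -[leRHS]mule1 lee_wpmul2l ?lee_fin ?powR_ge0//.
have ws : 0 < s / (s + t) by rewrite divr_gt0.
have wt : 0 < t / (s + t) by rewrite divr_gt0.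
apply: (@le_trans _ _ (\esum_(i in [set: I])
    ((s / (s + t))%:E * (s^-1%:E * a i) `^ q +
     (t / (s + t))%:E * (t^-1%:E * b i) `^ q))%E).
  by apply: le_esum => i _; exact: poweR_weighted_convex.
rewrite esumD; last 2 first.
- by move=> i _; rewrite mule_ge0 ?poweR_ge0// lee_fin ltW.
- by move=> i _; rewrite mule_ge0 ?poweR_ge0// lee_fin ltW.
apply: (@le_trans _ _ ((s / (s + t))%:E * 1 + (t / (s + t))%:E * 1)%E).
  apply: leeD.
    apply: le_trans (esumZl_le ws _) _; first by move=> i; exact: poweR_ge0.
    by rewrite lee_wpmul2l// lee_fin ltW.
  apply: le_trans (esumZl_le wt _) _; first by move=> i; exact: poweR_ge0.
  by rewrite lee_wpmul2l// lee_fin ltW.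
by rewrite !mule1 -EFinD -mulrDl mulfV ?gt_eqF.
Qed.

(** For the Fatou axiom at finite q it is enough to bound finite partial sums,
    where the limit in m can be taken term by term. *)
Lemma fatou_seminorm_lq (q : \bar R) (nu_ : I -> (T -> R) -> \bar R) (i0 : I) :
  (1 <= q)%E -> (forall i, fatou_seminorm mu (nu_ i)) ->
  fatou_seminorm mu (fun h => lq_norm q (fun i => nu_ i h)).
Proof.
case: q => [q| |]// q1 nuF; last by apply: fatou_seminorm_sup => //; exists i0.
have {}q1 : 1 <= q by rewrite -lee_fin.
have q0 : 0 < q by exact: lt_le_trans q1.
have nu0 i h : (0 <= nu_ i h)%E by exact: (fs_ge0 (nuF i) h).
split => [h||h l hh l0|g h gg hh|g h gg hh gh|h_ h c hh_ hh nd cv hc].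
- exact: poweR_ge0.
- apply/lq_norm_leP => //; rewrite esum1 ?lee_fin ?powR_ge0// => i _.
  by rewrite (fs0 (nuF i)) poweR0r// gt_eqF.
- apply: (@le_trans _ _ (lq_norm q%:E (fun i => l%:E * nu_ i h)%E)).
    by apply: le_lq_norm => // i; exact: (fs_leZ (nuF i) _ _).
  have -> : l%:E = ((l `^ q)%:E `^ q^-1)%E.
    by rewrite poweR_EFin -powRrM mulfV ?gt_eqF// powRr1// ltW.
  have S0 : (0 <= \esum_(i in [set: I]) nu_ i h `^ q)%E.
    by apply: esum_ge0 => i _; exact: poweR_ge0.
  rewrite -poweRM ?lee_fin ?powR_ge0// gt0_ler_poweR ?invr_ge0 ?(ltW q0)//.
  + rewrite in_itv/= leey andbT; apply: esum_ge0 => i _; exact: poweR_ge0.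
  + by rewrite in_itv/= leey andbT mule_ge0// lee_fin powR_ge0.
  rewrite (eq_esum (b := fun i => ((l `^ q)%:E * nu_ i h `^ q)%E)).
    apply: esumZl_le; first exact: powR_gt0.
    by move=> i; exact: poweR_ge0.
  move=> i _; rewrite poweRM ?poweR_ge0// -poweRrM mulVf ?gt_eqF// poweRe1//.
  by rewrite lee_fin powR_ge0.
- apply: le_trans (lq_norm_leD q1 _ _) => //.
  apply: le_lq_norm => // i; exact: (fs_leD (nuF i) _ _).
- by apply: le_lq_norm => // i; exact: (fs_le (nuF i) _ _ _).
- case: c hc => [c| |] hc; last 2 first.
  + by rewrite leey.
  + by have := le_trans (poweR_ge0 _ _) (hc 0%N).
  have c0 : 0 <= c by rewrite -lee_fin; apply: le_trans (hc 0%N); exact: poweR_ge0.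
  apply/lq_norm_leP => //; apply: ge_ereal_sup => _ [F [finF _] <-].
  pose u i m := (nu_ i (h_ m) `^ q)%E.
  have ndu i : nondecreasing_seq (u i).
    move=> m k mk; rewrite gt0_ler_poweR ?(ltW q0)// ?in_itv/= ?leey ?nu0//.
    by apply: (fs_le (nuF i)) => //; apply: aeW => x; exact: nd.
  pose l i := ereal_sup (range (u i)).
  have hl i : (nu_ i h `^ q <= l i)%E.
    have l0 : (0 <= l i)%E.
      by apply: ereal_sup_ge; exists (u i 0%N); [exists 0%N|exact: poweR_ge0].
    have -> : l i = ((l i `^ q^-1) `^ q)%E.
      by rewrite -poweRrM mulVf ?gt_eqF// poweRe1.
    rewrite gt0_ler_poweR ?(ltW q0)// ?in_itv/= ?leey ?nu0 ?poweR_ge0//.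
    apply: (fs_fatou (nuF i) hh_ hh nd cv) => m; apply: poweR_le_inv => //.
    by apply: ereal_sup_ubound; exists m.
  apply: (@le_trans _ _ (\sum_(i \in F) l i)%E); first exact: lee_fsum.
  rewrite fsbig_finite//.
  have cvu : (\sum_(i <- finmap.enum_fset (fset_set F)) u i m)%E @[m --> \oo] -->
      (\sum_(i <- finmap.enum_fset (fset_set F)) l i)%E.
    apply: cvg_nnesum => i _; first by apply: nearW => m; exact: poweR_ge0.
    exact: ereal_nondecreasing_cvgn.
  rewrite -(cvg_lim _ cvu)//; apply: lime_le; first by apply/cvg_ex; eexists; exact: cvu.
  apply: nearW => m; rewrite -fsbig_finite//.
  have /(lq_norm_leP q1 c0 (nu0 ^~ (h_ m))) := hc m.
  by apply: le_trans; apply: ereal_sup_ubound; exists F.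
Qed.

End lq_seminorm.

(** * Lebesgue measure on Euclidean space *)

Section lebesgue_euclid.
Context (R : realType) (n : nat).
Local Notation E := (euclid R n).
Local Notation mu := (@lebesgue_Rd R n).

Definition half_space (j : 'I_n.+1) (c : R) : set E := [set x | x ord0 j < c].

Definition cap_coord (j : 'I_n.+1) (c : R) (b : E) : E :=
  \row_i (if i == j then Num.min (b ord0 i) c else b ord0 i).

Definition cup_coord (j : 'I_n.+1) (c : R) (a : E) : E :=
  \row_i (if i == j then Num.max (a ord0 i) c else a ord0 i).

(** Cutting a box by the hyperplane x_j = c gives two boxes, one of which may be
    empty, and the volumes add up; this is what makes half-spaces measurable. *)
Lemma box_vol_split j c (a b : E) :
  box_vol a b = box_vol a (cap_coord j c b) + box_vol (cup_coord j c a) b.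
Proof.
rewrite /box_vol (bigD1 j)//= [in X in _ = X + _](bigD1 j)//=.
rewrite [in X in _ = _ + X](bigD1 j)//= !mxE eqxx.
rewrite [in X in _ = X + _](eq_bigr (fun i =>
  Num.max 0 (b ord0 i - a ord0 i))); last first.
  by move=> i /negbTE ij; rewrite !mxE ij.
rewrite [in X in _ = _ + X](eq_bigr (fun i =>
  Num.max 0 (b ord0 i - a ord0 i))); last first.
  by move=> i /negbTE ij; rewrite !mxE ij.
rewrite -mulrDl; congr (_ * _).
move: (a ord0 j) (b ord0 j) => u v.
rewrite /Num.max /Num.min; do ! case: ifPn; rewrite -?leNgt; lra.
Qed.

Lemma measurable_half_space j c : measurable (half_space j c).
Proof.
apply: (@le_caratheodory_measurable _ _ (@lebesgue_outer R n)) => X.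
apply: le_ereal_inf_tmp => _ [C XC <-].
rewrite (eq_eseriesr (g := fun k =>
    ((box_vol (C k).1 (cap_coord j c (C k).2))%:E +
     (box_vol (cup_coord j c (C k).1) (C k).2)%:E)%E)); last first.
  by move=> k _; rewrite -EFinD -box_vol_split.
rewrite nneseriesD; last 2 first.
- by move=> k _; rewrite lee_fin box_vol_ge0.
- by move=> k _; rewrite lee_fin box_vol_ge0.
apply: leeD.
- apply: ereal_inf_lbound; exists (fun k => ((C k).1, cap_coord j c (C k).2)) => //.
  move=> x [Xx xc]; have [k _ xk] := XC x Xx; exists k => //= i.
  rewrite mxE; case: eqVneq => [->|_]; last exact: xk.
  by have /andP[-> xb] := xk j; rewrite /= lt_min xb.
- apply: ereal_inf_lbound; exists (fun k => (cup_coord j c (C k).1, (C k).2)) => //.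
  move=> x [Xx /negP xc]; have [k _ xk] := XC x Xx; exists k => //= i.
  rewrite mxE; case: eqVneq => [->|_]; last exact: xk.
  by have /andP[ax ->] := xk j; rewrite ge_max ax leNgt xc.
Qed.

Lemma measurable_cube (r : R) k : measurable (@cube R n r k).
Proof.
rewrite (_ : cube r k = \bigcap_(j in [set: 'I_n.+1])
    (half_space j (r * ((k ord0 j)%:~R + 1)) `\`
     half_space j (r * (k ord0 j)%:~R))); last first.
  apply/seteqP; split => [x xk j _|x xk j].
    by have /andP[kx xk1] := xk j; split => //=; apply/negP; rewrite -leNgt.
  by have [/= -> /negP] := xk j I; rewrite -leNgt => ->.
apply: fin_bigcap_measurable => // j _.
by apply: measurableD; exact: measurable_half_space.
Qed.

(** An open set is the union of the grid cubes of mesh 1 / m that it contains,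
    and there are countably many of them. *)
Lemma open_measurable_euclid (U : set E) : open U -> measurable U.
Proof.
move=> oU.
rewrite (_ : U = \bigcup_(i in [set: nat * 'rV[int]_n.+1])
    (if `[< @cube R n (i.1.+1%:R^-1) i.2 `<=` U >]
     then @cube R n (i.1.+1%:R^-1) i.2 else set0)); last first.
  apply/seteqP; split => [x Ux|x [i _]]; last by case: asboolP => // + xi; apply.
  have : nbhs (x : 'rV[R]_n.+1) U by apply: open_nbhs_nbhs; split.
  move=> /nbhs_ballP[e /= e0 eU].
  pose m := Num.trunc e^-1; pose r : R := m.+1%:R^-1.
  have r0 : 0 < r by rewrite invr_gt0.
  have re : r < e by rewrite invf_plt ?posrE// truncnS_gt.
  pose k : 'rV[int]_n.+1 := \row_j Num.floor (r^-1 * x ord0 j).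
  have xk : @cube R n r k x.
    move=> j; rewrite mxE; apply/andP; split.
      by rewrite -ler_pdivlMl// ge_floor.
    by rewrite -ltr_pdivrMl// -[1]/(1%:~R) -intrD floorD1_gt.
  exists (m, k) => //; case: asboolP => //= nU; exfalso; apply: nU => y yk.
  apply: eU; split => // i j; rewrite (ord1 i) /ball/=.
  have /andP[x1 x2] := xk j; have /andP[y1 y2] := yk j.
  apply: le_lt_trans re.
  move: x1 x2 y1 y2; rewrite -/r mulrDr mulr1 => x1 x2 y1 y2.
  by rewrite ler_norml; apply/andP; split; lra.
apply: countable_bigcupT_measurable; first exact: countableP.
move=> i; case: asboolP => _; [exact: measurable_cube|exact: measurable0].
Qed.

Lemma compact_measurable_euclid (K : set E) : compact K -> measurable K.
Proof.
move=> cK; rewrite -[K]setCK; apply: measurableC; apply: open_measurable_euclid.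
apply: closed_openC; apply: (@compact_closed 'rV[R]_n.+1) => //.
Qed.

Definition dilation (c : R) : E -> E := fun x => c *: x.

Lemma dilationK (c : R) : c != 0 -> cancel (dilation c) (dilation c^-1).
Proof. by move=> c0 x; rewrite /dilation scalerA mulVf// scale1r. Qed.

(** A cover of A by boxes is pulled back to a cover of the preimage by boxes,
    and each volume is multiplied by c^-(n+1). *)
Lemma lebesgue_outer_dilation_le (c : R) (A : set E) : 0 < c ->
  (lebesgue_outer (dilation c @^-1` A) <= ((c ^- n.+1))%:E * lebesgue_outer A)%E.
Proof.
move=> c0; have cn0 : 0 < c ^- n.+1 by rewrite invr_gt0 exprn_gt0.
rewrite muleC -lee_pdivrMr//; apply: le_ereal_inf_tmp => _ [C AC <-].
rewrite lee_pdivrMr// muleC -nneseriesZl//; last first.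
  by move=> k _; rewrite lee_fin box_vol_ge0.
rewrite (eq_eseriesr (g := fun k =>
  (box_vol (dilation c^-1 (C k).1) (dilation c^-1 (C k).2))%:E)); last first.
  move=> k _; rewrite -EFinM; congr EFin; rewrite /box_vol.
  rewrite -exprVn -[X in _ ^+ X]card_ord -prodr_const -big_split/=.
  apply: eq_bigr => j _; rewrite !mxE -mulrBr maxr_pMr ?mulr0//.
  by rewrite invr_ge0 ltW.
apply: ereal_inf_lbound.
exists (fun k => (dilation c^-1 (C k).1, dilation c^-1 (C k).2)) => //.
move=> x Ax; have [k _ xk] := AC _ Ax; exists k => //= j.
by have := xk j; rewrite !mxE ler_pdivrMl// ltr_pdivlMl.
Qed.

(** The converse inequality is the first one for the inverse dilation. *)
Lemma lebesgue_outer_dilation (c : R) (A : set E) : 0 < c ->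
  (lebesgue_outer (dilation c @^-1` A) = ((c ^- n.+1))%:E * lebesgue_outer A)%E.
Proof.
move=> c0; apply/eqP; rewrite eq_le lebesgue_outer_dilation_le//=.
have ci0 : 0 < c^-1 by rewrite invr_gt0.
have cn0 : 0 < c ^- n.+1 by rewrite invr_gt0 exprn_gt0.
have := lebesgue_outer_dilation_le (dilation c @^-1` A) ci0.
rewrite -comp_preimage (_ : _ \o _ = id); last first.
  by apply/funext => x /=; rewrite -[X in dilation X]invrK dilationK// gt_eqF.
rewrite preimage_id => H; apply: le_trans (lee_wpmul2l _ H) _.
  by rewrite lee_fin ltW.
by rewrite muleA -EFinM exprVn invrK mulVf ?mul1e// gt_eqF// exprn_gt0.
Qed.

(** The Caratheodory condition for the preimage of A, tested on X, is the one for
    A tested on the image of X, multiplied by a constant. *)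
Lemma measurable_dilation (c : R) : 0 < c ->
  measurable_fun [set: E] (dilation c).
Proof.
move=> c0 _ A mA; rewrite setTI.
have ci0 : c^-1 > 0 by rewrite invr_gt0.
apply: (@le_caratheodory_measurable _ _ (@lebesgue_outer R n)) => X.
have -> : X = dilation c @^-1` (dilation c^-1 @^-1` X).
  rewrite -comp_preimage (_ : _ \o _ = id) ?preimage_id//.
  by apply/funext => x /=; rewrite dilationK// gt_eqF.
set Y := dilation c^-1 @^-1` X.
rewrite preimage_setC -!preimage_setI.
have oE B : lebesgue_outer (dilation c @^-1` B) =
    ((c ^- n.+1)%:E * lebesgue_outer B)%E.
  exact: lebesgue_outer_dilation.
change (lebesgue_outer (dilation c @^-1` (Y `&` A)) +
  lebesgue_outer (dilation c @^-1` (Y `&` ~` A)) <=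
  lebesgue_outer (dilation c @^-1` Y))%E.
rewrite !oE -ge0_muleDr ?lebesgue_outer_ge0//.
by have -> := mA Y.
Qed.

Lemma dilation_null (c : R) (A : set E) : 0 < c -> measurable A ->
  mu A = 0%E -> mu (dilation c @^-1` A) = 0%E.
Proof.
move=> c0 _ A0; rewrite /lebesgue_Rd lebesgue_outer_dilation//.
by rewrite [lebesgue_outer A]A0 mule0.
Qed.

(** A compact set is bounded in the sup norm, so the integer parts of the
    coordinates of its points take finitely many values. *)
Lemma compact_sub_cubes (K : set E) : compact K ->
  exists s : seq 'rV[int]_n.+1, K `<=` [set x | exists2 k, k \in s & cube 1 k x].
Proof.
move=> cK; have [M [_ MK]] := @compact_bounded R 'rV[R]_n.+1 K cK.
have {}MK : forall x, K x -> forall j, `|x ord0 j| <= M + 1.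
  move=> x Kx j; apply: le_trans (MK (M + 1) _ x Kx); last by rewrite ltrDl.
  rewrite -[leRHS]/(mx_norm (x : 'rV[R]_n.+1)) mx_normrE.
  by apply: (le_bigmax _ _ (ord0, j)).
pose N := (Num.trunc (M + 1)).+1.
have KN x j : K x -> `|x ord0 j| < N%:R.
  by move=> Kx; apply: le_lt_trans (MK x Kx j) _; exact: truncnS_gt.
pose kk (f : {ffun 'I_n.+1 -> 'I_(N + N)}) : 'rV[int]_n.+1 :=
  \row_j ((f j)%:Z - N%:Z).
exists [seq kk f | f <- enum {ffun 'I_n.+1 -> 'I_(N + N)}] => x Kx.
have flo j : (0 <= Num.floor (x ord0 j) + N%:Z)%R.
  have /ltr_normlP[xN _] := KN x j Kx.
  rewrite -lerBlDr sub0r floor_ge_int intrN ltW//.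
  by rewrite ltrNl.
have fhi j : (absz (Num.floor (x ord0 j) + N%:Z)%R < N + N)%N.
  have /ltr_normlP[_ xN] := KN x j Kx.
  by rewrite -ltz_nat gez0_abs ?flo// PoszD ltrD2r floor_lt_int.

pose f := [ffun j => Ordinal (fhi j)].
exists (kk f); first by apply: map_f; rewrite mem_enum.
move=> j; rewrite !mxE ffunE/= gez0_abs ?flo// addrK !mul1r ge_floor/=.
by rewrite -[1]/(1%:~R) -intrD floorD1_gt.
Qed.

End lebesgue_euclid.

(** * Function spaces given by a seminorm of the modulus *)

Section modulus.
Context (R : realType).
Local Open Scope complex_scope.
Implicit Types z w : R[i].

(** The absolute value of a complex number is itself a complex number; this is
    the real number that it comes from. *)
Definition modulus z : R := complex.Re `|z|.

Lemma modulusE z :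
  modulus z = Num.sqrt ((complex.Re z) ^+ 2 + (complex.Im z) ^+ 2).
Proof. by rewrite /modulus normc_def. Qed.

Lemma norm_modulus z : `|z| = (modulus z)%:C.
Proof. by rewrite modulusE normc_def. Qed.

Lemma modulus_ge0 z : 0 <= modulus z.
Proof. by rewrite modulusE sqrtr_ge0. Qed.

Lemma modulusD z w : modulus (z + w) <= modulus z + modulus w.
Proof.
by rewrite -lecR rmorphD/= -!norm_modulus; exact: ler_normD.
Qed.

Lemma modulusM z w : modulus (z * w) = modulus z * modulus w.
Proof.
by apply: (@complexI R); rewrite rmorphM/= -!norm_modulus normrM.
Qed.

Lemma modulus_real (a : R) : modulus a%:C = `|a|.
Proof. by rewrite modulusE/= expr0n addr0 sqrtr_sqr. Qed.

Lemma modulus_nneg (a : R) : 0 <= a -> modulus a%:C = a.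
Proof. by move=> a0; rewrite modulus_real ger0_norm. Qed.

Lemma modulus_norm z : modulus `|z| = modulus z.
Proof. by rewrite /modulus normr_id. Qed.

Lemma modulus0 : modulus 0 = 0.
Proof. by rewrite /modulus normr0. Qed.

Lemma modulus_eq0 z : modulus z = 0 -> z = 0.
Proof. by move=> z0; apply/normr0_eq0; rewrite norm_modulus z0. Qed.

Lemma distC_modulus z w : modulus (z - w) = modulus (w - z).
Proof. by rewrite /modulus distrC. Qed.

Lemma le_modulus z w : 0 <= z -> z <= w -> modulus z <= modulus w.
Proof.
move=> z0 zw; rewrite -lecR -!norm_modulus !ger0_norm//.
exact: le_trans zw.
Qed.

Lemma modulus_le_ReIm z :
  modulus z <= `|complex.Re z| + `|complex.Im z|.
Proof.
case: z => a b; rewrite (_ : a +i* b = a%:C + 'i * b%:C); last by simpc.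
apply: le_trans (modulusD _ _) _; rewrite modulusM !modulus_real.
rewrite [modulus 'i]modulusE/= expr0n expr1n add0r sqrtr1 mul1r.
by simpc.
Qed.

Lemma Re_le_modulus z : `|complex.Re z| <= modulus z.
Proof.
by rewrite modulusE -sqrtr_sqr ler_wsqrtr// lerDl sqr_ge0.
Qed.

Lemma Im_le_modulus z : `|complex.Im z| <= modulus z.
Proof.
by rewrite modulusE -sqrtr_sqr ler_wsqrtr// lerDr sqr_ge0.
Qed.

End modulus.

Section fatou_norm_space.
Context (R : realType) (n : nat).
Local Notation E := (euclid R n).
Local Notation mu := (@lebesgue_Rd R n).
Variable nu : (E -> R) -> \bar R.
Hypothesis nuF : fatou_seminorm mu nu.
Hypothesis nu_eq0 : forall h, mnneg h -> nu h = 0%E -> {ae mu, forall x, h x = 0}.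
Implicit Types f g : E -> R[i].
Local Open Scope complex_scope.

Let N f := nu (fun x => modulus (f x)).

Lemma mnneg_modulus f : L0 f -> mnneg (fun x => modulus (f x)).
Proof.
move=> [mRe mIm]; split => [|x]; last exact: modulus_ge0.
under eq_fun do rewrite modulusE.
apply: (measurableT_comp (continuous_measurable_fun (@sqrt_continuous R))).
by apply: measurable_funD; exact: measurable_funX.
Qed.

Lemma L0D f g : L0 f -> L0 g -> L0 (fun x => f x + g x).
Proof.
move=> [fR fI] [gR gI]; split.
  rewrite (_ : (fun x => _) = fun x => complex.Re (f x) + complex.Re (g x)).
    exact: measurable_funD.
  by apply/funext => x; case: (f x) (g x) => a b [].
rewrite (_ : (fun x => _) = fun x => complex.Im (f x) + complex.Im (g x)).
  exact: measurable_funD.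
by apply/funext => x; case: (f x) (g x) => a b [].
Qed.

Lemma L0Z (l : E -> R) f : measurable_fun [set: E] l -> L0 f ->
  L0 (fun x => (l x)%:C * f x).
Proof.
move=> ml [fR fI]; split.
  rewrite (_ : (fun x => _) = fun x => l x * complex.Re (f x)).
    exact: measurable_funM.
  by apply/funext => x; case: (f x) => a b /=; rewrite mul0r subr0.
rewrite (_ : (fun x => _) = fun x => l x * complex.Im (f x)).
  exact: measurable_funM.
by apply/funext => x; case: (f x) => a b /=; rewrite mul0r addr0.
Qed.

Lemma L0B f g : L0 f -> L0 g -> L0 (fun x => f x - g x).
Proof.
move=> ff gg; have := L0D ff (L0Z (@measurable_cst _ _ _ _ _ (-1 : R)) gg).
congr L0; apply/funext => x /=; rewrite rmorphN1 mulN1r//.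
Qed.

Lemma function_norm_modulus : function_norm N.
Proof.
have mn f : L0_plus f -> mnneg (fun x => modulus (f x)).
  by move=> [Lf _]; exact: mnneg_modulus.
have monotone f g : L0_plus f -> L0_plus g ->
    {ae mu, forall x, f x <= g x} -> (N f <= N g)%E.
  move=> ff gg fg; apply: (fs_le nuF); [exact: mn..|].
  by apply: filterS2 ff.2 fg => x f0 fg; exact: le_modulus.
split => //.
- move=> f g ff gg fg; apply/eqP; rewrite eq_le; apply/andP; split.
    by apply: monotone => //; apply: filterS fg => x ->.
  by apply: monotone => //; apply: filterS fg => x ->.
- by move=> f _; exact: (fs_ge0 nuF).
- move=> f ff; split => [/(nu_eq0 (mn _ ff))|f0].
    by apply: filterS => x /modulus_eq0.
  apply/eqP; rewrite eq_le (fs_ge0 nuF) andbT; apply: le_trans (fs_le0 nuF).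
  apply: (fs_le nuF); [exact: mn|exact: mnneg_cst0|].
  by apply: filterS f0 => x ->; rewrite modulus0.
- move=> f l ff l0; rewrite -[RHS](fsZ nuF (mn _ ff) l0).
  by congr nu; apply/funext => x; rewrite modulusM modulus_nneg.
- move=> f g ff gg; apply: le_trans (fs_leD nuF (mn _ ff) (mn _ gg)).
  apply: (fs_le nuF).
  + by apply: mnneg_modulus; apply: L0D; [exact: ff.1|exact: gg.1].
  + by apply: mnnegD; exact: mn.
  + by apply: aeW => x; exact: modulusD.
Qed.

Let X := [set f : E -> R[i] | L0 f /\ (N f < +oo)%E].

Lemma kothe_norm_modulus f : kothe_norm N f = N f.
Proof. by congr nu; apply/funext => x; rewrite modulus_norm. Qed.

Lemma normed_kothe_modulus : normed_kothe_space X N.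
Proof.
exists N; split; first exact: function_norm_modulus.
  by apply/funext => f; rewrite /X /kothe_space/= kothe_norm_modulus.
by move=> f _; rewrite kothe_norm_modulus.
Qed.

(** Almost everywhere |f| is the supremum of the increasing |f_m|, so the
    domination lemma bounds nu |f| by the supremum of the nu |f_m|, and
    monotonicity gives the reverse bound. *)
Lemma fatou_property_modulus : fatou_property X N.
Proof.
move=> f_ f Xf Lf [f0 fnd fcv] Nfin.
set S := ereal_sup _ in Nfin.
have mf m : mnneg (fun x => modulus (f_ m x)).
  by apply: mnneg_modulus; exact: (Xf m).1.
have ndae : {ae mu, forall x, nondecreasing_seq (fun m => modulus (f_ m x))}.
  apply: filterS2 (ae_foralln f0) (ae_foralln fnd) => x fx0 fxnd.
  by apply/nondecreasing_seqP => m; exact: le_modulus.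
have cvx x : complex.Re `|f_ m x - f x| @[m --> \oo] --> (0 : R) ->
    modulus (f_ m x) @[m --> \oo] --> modulus (f x).
  move=> /cvgrPdist_le cv; apply/cvgrPdist_le => e e0.
  apply: filterS (cv e e0) => m; rewrite sub0r normrN ger0_norm ?modulus_ge0//.
  apply: le_trans; rewrite ler_norml; apply/andP; split.
    rewrite lerNl opprB lerBlDr.
    by have := modulusD (f_ m x - f x) (f x); rewrite subrK.
  rewrite lerBlDr -[complex.Re _]/(modulus _) distC_modulus.
  by have := modulusD (f x - f_ m x) (f_ m x); rewrite subrK.
have supx x : nondecreasing_seq (fun m => modulus (f_ m x)) ->
    complex.Re `|f_ m x - f x| @[m --> \oo] --> (0 : R) ->
    (modulus (f x))%:E = ereal_sup (range (fun m => (modulus (f_ m x))%:E)).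
  move=> nd /cvx cv; apply: (@cvg_unique _ _ ((modulus (f_ m x))%:E @[m --> \oo])) => //.
    by apply: cvg_EFin => //; exact: nearW.
  by apply: ereal_nondecreasing_cvgn => m k mk; rewrite lee_fin nd.
have NfS : (N f <= S)%E.
  apply: (fs_fatou_dominated nuF mf (mnneg_modulus Lf)).
    by apply: filterS2 ndae fcv => x nd cv; split => //; rewrite (supx x nd cv).
  by move=> m; apply: ereal_sup_ubound; exists m.
have SNf : (S <= N f)%E.
  apply: ge_ereal_sup => _ [m _ <-].
  apply: (fs_le nuF (mf m) (mnneg_modulus Lf)).
  apply: filterS2 ndae fcv => x nd cv.
  by rewrite -lee_fin (supx x nd cv); apply: ereal_sup_ubound; exists m.
split; first by split => //; exact: le_lt_trans Nfin.
have -> : N f = S by apply/eqP; rewrite eq_le NfS.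
apply: ereal_nondecreasing_cvgn => m k mk; apply: (fs_le nuF (mf m) (mf k)).
by apply: filterS ndae => x nd; exact: nd.
Qed.

End fatou_norm_space.

(** * Completeness *)

Section riesz_fischer.
Context (R : realType) (n : nat).
Local Notation E := (euclid R n).
Local Notation mu := (@lebesgue_Rd R n).
Variable nu : (E -> R) -> \bar R.
Hypothesis nuF : fatou_seminorm mu nu.
Hypothesis nu_eq0 : forall h, mnneg h -> nu h = 0%E -> {ae mu, forall x, h x = 0}.
Local Open Scope complex_scope.

Lemma sum_half_tail k m :
  \sum_(j < m) (2^-1 : R) ^+ (k + j) <= 2 * (2^-1) ^+ k.
Proof.
suff -> : \sum_(j < m) (2^-1 : R) ^+ (k + j) =
    2 * (2^-1) ^+ k - 2 * (2^-1) ^+ (k + m).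
  by rewrite gerBl mulr_ge0// exprn_ge0// invr_ge0.
elim: m => [|m IH]; first by rewrite big_ord0 addn0 subrr.
by rewrite big_ord_recr/= IH addnS exprS; field.
Qed.

(** Increments dominated by a bounded series make a sequence converge; the bound
    is an extended real because it is used with the supremum of partial sums. *)
Lemma cvg_telescope_bounded (z_ : nat -> R) (g : nat -> R) (S : \bar R) :
  (S < +oo)%E -> (forall j, `|z_ j.+1 - z_ j| <= g j) ->
  (forall m, (\sum_(j < m) g j)%:E <= S)%E -> cvgn z_.
Proof.
move=> Soo zg gS.
have S0 : (0 <= S)%E by have := gS 0%N; rewrite big_ord0.
have g0 j : 0 <= g j by exact: le_trans (zg j).
have cg : cvgn (series g).
  apply: nondecreasing_is_cvgn.
    apply/nondecreasing_seqP => m.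
    by rewrite /series/= big_nat_recr//= lerDl.
  exists (fine S) => _ [m _ <-]; rewrite -lee_fin fineK ?ge0_fin_numE//.
  by rewrite /series/= big_mkord.
have cz : cvgn (series (fun j => z_ j.+1 - z_ j)).
  apply: normed_cvg; apply: series_le_cvg cg => // j /=; exact: normr_ge0.
move: cz => /cvg_ex[l cl]; apply/cvg_ex; exists (z_ 0%N + l).
have zE : z_ =1 (fun m => z_ 0%N + series (fun j => z_ j.+1 - z_ j) m).
  by move=> m; rewrite /series/= telescope_sumr// addrC subrK.
by rewrite (eq_cvg _ _ zE); apply: cvgD => //; exact: cvg_cst.
Qed.

(** Multiplying by the indicator of the complement of B makes the sequence converge
    everywhere, and hence the limit measurable. *)
Lemma measurable_limit_off d (T : measurableType d) (B : set T) (u : nat -> T -> R) :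
  measurable B -> (forall k, measurable_fun [set: T] (u k)) ->
  (forall x, ~ B x -> cvgn (u ^~ x)) ->
  exists2 l : T -> R, measurable_fun [set: T] l &
    forall x, ~ B x -> u ^~ x @ \oo --> l x.
Proof.
move=> mB mu cu; pose v k x : R := \1_(~` B) x * u k x.
have vB x : B x -> v ^~ x = cst 0.
  by move=> Bx; apply/funext => k; rewrite /v indicE memNset ?mul0r//= => /(_ Bx).
have vNB x : ~ B x -> v ^~ x = u ^~ x.
  by move=> nBx; apply/funext => k; rewrite /v indicE mem_set// mul1r.
exists (fun x => limn (v ^~ x)); last by move=> x nBx; rewrite vNB//; exact: cu.
apply: (measurable_fun_cvg (h := v)) => [k|x _].
  apply: measurable_funM => //.
  by apply: measurable_indic; exact: measurableC.
have [Bx|nBx] := pselect (B x); last by rewrite vNB//; exact: cu.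
by rewrite vB// lim_cst//; exact: cvg_cst.
Qed.

Lemma L0_limit_off (B : set E) (f_ : nat -> E -> R[i]) : measurable B ->
  (forall k, L0 (f_ k)) ->
  (forall x, ~ B x -> cvgn (fun k => complex.Re (f_ k x)) /\
                      cvgn (fun k => complex.Im (f_ k x))) ->
  exists2 f : E -> R[i], L0 f & forall x, ~ B x ->
    (fun k => complex.Re (f_ k x)) @ \oo --> complex.Re (f x) /\
    (fun k => complex.Im (f_ k x)) @ \oo --> complex.Im (f x).
Proof.
move=> mB Lf cf.
have [lR mlR cR] := measurable_limit_off mB (fun k => (Lf k).1)
  (fun x nBx => (cf x nBx).1).
have [lI mlI cI] := measurable_limit_off mB (fun k => (Lf k).2)
  (fun x nBx => (cf x nBx).2).
exists (fun x => Complex (lR x) (lI x)); first by split.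
by move=> x nBx; split; [exact: cR|exact: cI].
Qed.

(** Along a subsequence s with nu |f_(s (j+1)) - f_(s j)| <= 2^-j, the sums of the
    increments from rank k on have seminorm at most 2 2^-k.  They are therefore
    finite almost everywhere, so the subsequence converges there to some f, and
    they dominate |f - f_(s k)|. *)
Lemma norm_complete_modulus :
  norm_complete [set f : E -> R[i] | L0 f /\ (nu (fun x => modulus (f x)) < +oo)%E]
    (fun f => nu (fun x => modulus (f x))).
Proof.
move=> f_ Xf cauchy.
have half0 j : 0 < (2^-1 : R) ^+ j by rewrite exprn_gt0// invr_gt0.
have /choice[M MP] j := cauchy ((2^-1) ^+ j) (half0 j).
(* The maximum makes s nondecreasing, so that consecutive terms are both beyond
   the rank M j. *)
pose s j := (\max_(i < j.+1) M i)%N.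
have sM j : (M j <= s j)%N by exact: (leq_bigmax (F := fun i : 'I_j.+1 => M i) ord_max).
have sS j : (s j <= s j.+1)%N by rewrite [in leqRHS]/s big_ord_recr/= leq_maxl.
pose d j x := modulus (f_ (s j.+1) x - f_ (s j) x).
have md j : mnneg (d j).
  by apply: mnneg_modulus; apply: L0B; exact: (Xf _).1.
have nud j : (nu (d j) <= ((2^-1) ^+ j)%:E)%E.
  by apply/ltW/MP => //; exact: leq_trans (sM j) (sS j).
pose g k m x := \sum_(j < m) d (k + j)%N x.
have mg k m : mnneg (g k m).
  by apply: (mnneg_sum (h_ := fun j => d (k + j)%N)) => j; exact: md.
have gnd k x : nondecreasing_seq (g k ^~ x).
  apply/nondecreasing_seqP => m; rewrite /g big_ord_recr/= lerDl.
  exact: (md _).2.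
have nug k m : (nu (g k m) <= (2 * (2^-1) ^+ k)%:E)%E.
  apply: le_trans (fs_sum_le nuF (h_ := fun j => d (k + j)%N) m _) _ => //.
  apply: (@le_trans _ _ (\sum_(j < m) ((2^-1) ^+ (k + j))%:E)%E).
    by apply: lee_sum => j _; exact: nud.
  by rewrite sumEFin lee_fin sum_half_tail.
have [B [mB muB0 Bsub]] := fs_finite_ae nuF nu_eq0 (mg 0%N) (gnd 0%N) (nug 0%N).
have good x : ~ B x ->
    (ereal_sup (range (fun m => (g 0%N m x)%:E)) < +oo)%E.
  by move=> nBx; apply: contrapT => P; apply/nBx/Bsub.
have aeB : {ae mu, forall x, ~ B x}.
  by exists B; split => // x /= /contrapT.
have cvgz (r : R[i] -> R) x : (forall z w, `|r z - r w| <= modulus (z - w)) ->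
    ~ B x -> cvgn (fun k => r (f_ (s k) x)).
  move=> rle nBx; apply: (cvg_telescope_bounded (good x nBx) (g := d ^~ x)).
    by move=> j; exact: rle.
  by move=> m; apply: ereal_sup_ubound; exists m.
have ReP (z w : R[i]) : `|complex.Re z - complex.Re w| <= modulus (z - w).
  apply: le_trans (Re_le_modulus (z - w)).
  by case: z w => a b [].
have ImP (z w : R[i]) : `|complex.Im z - complex.Im w| <= modulus (z - w).
  apply: le_trans (Im_le_modulus (z - w)).
  by case: z w => a b [].
have [f Lf cf] := L0_limit_off (f_ := fun k => f_ (s k)) mB
  (fun k => (Xf (s k)).1) (fun x nBx => conj (cvgz _ x ReP nBx) (cvgz _ x ImP nBx)).
have Ldiff k : L0 (fun x => f x - f_ k x) by exact: (L0B Lf (Xf k).1).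
have tail k : (nu (fun x => modulus (f x - f_ (s k) x)%R) <=
    (2 * (2^-1) ^+ k)%:E)%E.
  apply: (fs_fatou_dominated nuF (mg k) (mnneg_modulus (Ldiff (s k))) _ (nug k)).
  apply: filterS aeB => x nBx; split; first exact: gnd.
  set S := ereal_sup _.
  apply/lee_addgt0Pr => e e0.
  have e20 : 0 < e / 2 by rewrite divr_gt0.
  (* Any index k + K with K beyond the rank where f_(s m) x is e-close to f x
     will do. *)
  have [K _ KP] : \forall m \near \oo, modulus (f x - f_ (s m) x) <= e.
    have /cvgrPdist_le/(_ _ e20) cR := (cf x nBx).1.
    have /cvgrPdist_le/(_ _ e20) cI := (cf x nBx).2.
    apply: filterS2 cR cI => m cR cI.
    apply: le_trans (modulus_le_ReIm _) _; rewrite [e]splitr.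
    move: cR cI; case: (f x) (f_ (s m) x) => a b [a' b'] /=; exact: lerD.
  have path m : modulus (f_ (s (k + m)%N) x - f_ (s k) x) <= g k m x.
    elim: m => [|m IH]; first by rewrite addn0 subrr modulus0 /g big_ord0.
    rewrite /g big_ord_recr/= -/(g k m x).
    rewrite (_ : f_ (s (k + m.+1)%N) x - _ = (f_ (s (k + m)%N) x - f_ (s k) x) +
      (f_ (s (k + m).+1) x - f_ (s (k + m)%N) x)).
      by apply: le_trans (modulusD _ _) _; rewrite lerD2r.
    by rewrite addnS [RHS]addrC addrA subrK.
  apply: (@le_trans _ _ ((g k K x)%:E + e%:E)%E); last first.
    by rewrite leeD2r//; apply: ereal_sup_ubound; exists K.
  rewrite -EFinD lee_fin [leRHS]addrC.
  have := modulusD (f x - f_ (s (k + K)%N) x) (f_ (s (k + K)%N) x - f_ (s k) x).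
  rewrite addrA subrK => /le_trans; apply; apply: lerD => //.
  by apply: KP; rewrite /= leq_addl.
exists f.
  split => //.
  apply: (@le_lt_trans _ _ (nu (fun x => modulus (f x - f_ (s 0%N) x)%R) +
    nu (fun x => modulus (f_ (s 0%N) x)))%E).
    have mf0 := mnneg_modulus (Xf (s 0%N)).1.
    have mdf0 := mnneg_modulus (Ldiff (s 0%N)).
    apply: le_trans (fs_leD nuF mdf0 mf0).
    apply: (fs_le nuF); [exact: mnneg_modulus|exact: mnnegD|].
    apply: aeW => x; have := modulusD (f x - f_ (s 0%N) x) (f_ (s 0%N) x).
    by rewrite subrK.
  apply: lte_add_pinfty; last exact: (Xf _).2.
  by apply: le_lt_trans (tail 0%N) _; rewrite ltry.
have close k m : (s k <= m)%N ->
    (nu (fun x => modulus (f_ m x - f x)%R) <= (3 * (2^-1) ^+ k)%:E)%E.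
  move=> km.
  have m1 : mnneg (fun x => modulus (f_ m x - f_ (s k) x)).
    by apply: mnneg_modulus; apply: L0B; exact: (Xf _).1.
  have m2 := mnneg_modulus (Ldiff (s k)).
  apply: (@le_trans _ _ (nu (fun x => modulus (f_ m x - f_ (s k) x)%R) +
    nu (fun x => modulus (f x - f_ (s k) x)%R))%E).
    apply: le_trans (fs_leD nuF m1 m2).
    apply: (fs_le nuF); [|exact: mnnegD|].
      exact: mnneg_modulus (L0B (Xf m).1 Lf).
    apply: aeW => x; rewrite (distC_modulus (f x)).
    have := modulusD (f_ m x - f_ (s k) x) (f_ (s k) x - f x).
    by rewrite addrA subrK.
  have -> : 3 * (2^-1 : R) ^+ k = (2^-1) ^+ k + 2 * (2^-1) ^+ k by ring.
  rewrite EFinD; apply: leeD; last exact: tail.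
  apply/ltW/MP => //; exact: leq_trans (sM k) km.
apply/fine_cvgP; split.
  exists (s 0%N) => // m /= km; rewrite ge0_fin_numE ?(fs_ge0 nuF)//.
  by apply: le_lt_trans (close 0%N m km) _; rewrite ltry.
apply/cvgrPdist_le => e e0.
have [k ke] : exists k, 3 * (2^-1 : R) ^+ k <= e.
  have e30 : 0 < e / 3 by rewrite divr_gt0.
  have /cvgrPdist_le/(_ _ e30) [k _ /(_ k (leqnn k))] :
      (fun k => (2^-1 : R) ^+ k) @ \oo --> 0.
    by apply: cvg_expr; rewrite ger0_norm ?invr_ge0// invf_lt1// ltr1n.
  rewrite sub0r normrN ger0_norm ?(ltW (half0 k))// => ke.
  by exists k; rewrite mulrC -ler_pdivlMr.
exists (s k) => // m /= km.
rewrite sub0r normrN ger0_norm ?fine_ge0 ?(fs_ge0 nuF)//.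
apply: le_trans ke; rewrite -lee_fin fineK; first exact: close.
rewrite ge0_fin_numE ?(fs_ge0 nuF)//.
by apply: le_lt_trans (close k m km) _; rewrite ltry.
Qed.

End riesz_fischer.

(** * The Fofana norm *)

Section fofana_space.
Context (R : realType) (n : nat).
Local Notation E := (euclid R n).
Local Notation mu := (@lebesgue_Rd R n).
Variable p : E -> \bar R.
Variables alpha q : \bar R.
Hypotheses (pE : variable_exponent p) (q1 : (1 <= q)%E).
Implicit Types f : E -> R[i].
Local Open Scope complex_scope.

Let gaugeF : fatou_seminorm mu (gauge mu p).
Proof. exact: fatou_seminorm_gauge pE.1 pE.2. Qed.

(** The amalgam norm of the rho-dilate of a function of modulus h, with the weight
    and the truncation to cubes put in front so that it is visibly built by
    [fatou_seminorm_comp] and [fatou_seminorm_lq]. *)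
Definition amalgam_gauge (rho : R) (h : E -> R) : \bar R :=
  lq_norm q (fun k : 'rV[int]_n.+1 => gauge mu p (fun x : E =>
    rho `^ (- dim_div n alpha) * \1_(@cube R n 1 k) x * h (dilation rho^-1 x))).

Definition fofana_gauge (h : E -> R) : \bar R :=
  ereal_sup [set amalgam_gauge rho h | rho in [set rho : R | 0 < rho]].

Lemma luxemburgE f : luxemburg p f = gauge mu p (fun x => modulus (f x)).
Proof.
rewrite /luxemburg /gauge; congr ereal_inf.
have modE l : 0 < l -> modular p (fun x => (l^-1)%:C * f x) =
    gauge_modular mu p (fun x => l^-1 * modulus (f x)).
  move=> l0; apply: eq_integral => x _; congr epow.
  by rewrite -/(modulus _) modulusM modulus_nneg// invr_ge0 ltW.
by apply/seteqP; split => _ [l [l0 lf] <-]; exists l => //; split => //;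
  rewrite ?modE// -modE.
Qed.

Lemma modulus_restr f A x : modulus (restr f A x) = \1_A x * modulus (f x).
Proof.
rewrite /restr modulusM mulrC; congr (_ * _).
rewrite !indicE; case: (x \in A); last exact: modulus0.
by rewrite -[RHS](@modulus_nneg R 1).
Qed.

Lemma fofana_normE f : fofana_norm p q alpha f = fofana_gauge (fun x => modulus (f x)).
Proof.
suff E : (fun rho : R => amalgam_norm p q (St alpha rho f)) =
    (fun rho => amalgam_gauge rho (fun x => modulus (f x))).
  exact: (congr1 (fun F => ereal_sup [set F rho | rho in [set rho : R | 0 < rho]]) E).
apply/funext => rho; rewrite /amalgam_norm /amalgam_gauge.
congr lq_norm; apply/funext => k; rewrite luxemburgE; congr gauge.
apply/funext => x; rewrite modulus_restr /St modulusM.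
by rewrite modulus_nneg ?powR_ge0// mulrCA mulrA.
Qed.

Lemma fatou_seminorm_fofana : fatou_seminorm mu fofana_gauge.
Proof.
apply: fatou_seminorm_sup => [|rho /= rho0]; first by exists 1; exact: ltr01.
have rhoi0 : 0 < rho^-1 by rewrite invr_gt0.
apply: (fatou_seminorm_lq 0 q1) => k.
apply: (fatou_seminorm_comp _ (measurable_dilation rhoi0) _ gaugeF).
- apply: mnnegZ; first exact: powR_ge0.
  by apply: mnneg_indic; exact: measurable_cube.
- by move=> A mA A0; exact: dilation_null.
Qed.

Lemma lq_norm_ge (I : choiceType) (a : I -> \bar R) k :
  (forall i, 0 <= a i)%E -> (a k <= lq_norm q a)%E.
Proof.
move=> a0; case: q q1 => [r| |]// r1; last by apply: ereal_sup_ubound; exists k.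
have r0 : 0 < r by exact: (@lt_le_trans _ _ 1).
apply: poweR_le_inv => //; apply: esum_ge; exists [set k].
  by split => //; exact: finite_set1.
by rewrite fsbig_set1.
Qed.

(** The term rho = 1 of the supremum, and then a single entry of the family. *)
Lemma gauge_cube_le (h : E -> R) k :
  (gauge mu p (fun x => \1_(cube 1 k) x * h x)%R <= fofana_gauge h)%E.
Proof.
pose a := fun i : 'rV[int]_n.+1 => gauge mu p (fun x => \1_(cube 1 i) x * h x).
apply: (@le_trans _ _ (lq_norm q a)).
  by apply: (lq_norm_ge (a := a)) => i; exact: gauge_ge0.
apply: ereal_sup_ubound; exists 1; first exact: ltr01.
congr lq_norm; apply/funext => i; congr gauge; apply/funext => x.
by rewrite powR1 mul1r /dilation invr1 scale1r.
Qed.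

(** The function vanishes almost everywhere on each unit cube, and the cubes are
    countably many, indexed here through [unpickle], and cover the space. *)
Lemma fofana_gauge_eq0 (h : E -> R) : mnneg h -> fofana_gauge h = 0%E ->
  {ae mu, forall x, h x = 0}.
Proof.
move=> hh h0.
have hk (k : 'rV[int]_n.+1) : mnneg (fun x : E => \1_(@cube R n 1 k) x * h x : R).
  exact: (mnnegM (mnneg_indic R (measurable_cube 1 k)) hh).
have ae0 (m : nat) : {ae mu, forall x,
    if unpickle m is Some k then \1_(@cube R n 1 k) x * h x = 0 else True}.
  case: (unpickle m) => [k|]; last exact: aeW.
  apply: (gauge_eq0 pE.1 pE.2 (hk k)); apply/eqP; rewrite eq_le gauge_ge0 andbT.
  by rewrite -h0 gauge_cube_le.
apply: filterS (ae_foralln ae0) => x hx.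
pose k : 'rV[int]_n.+1 := \row_j Num.floor (x ord0 j).
have := hx (pickle k); rewrite pickleK indicE mem_set ?mul1r// => j.
by rewrite !mxE !mul1r ge_floor/= -[1]/(1%:~R) -intrD floorD1_gt.
Qed.

(** A compact K is covered by finitely many unit cubes, so the truncation of f to K
    is dominated by a finite sum of pieces of finite norm. *)
Lemma fofana_loc f : L0 f -> (fofana_norm p q alpha f < +oo)%E -> Lp_loc p f.
Proof.
rewrite fofana_normE => Lf foo; split; first exact: Lf.
move=> K cK.
have mK : measurable K by exact: compact_measurable_euclid.
split.
  rewrite (_ : restr f K = fun x => (\1_K x)%:C * f x).
    by apply: L0Z => //; exact: measurable_indic.
  apply/funext => x; rewrite /restr mulrC; congr (_ * _).
  by rewrite !indicE; case: (x \in K).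
rewrite luxemburgE (_ : (fun x => _) = fun x => \1_K x * modulus (f x)); last first.
  by apply/funext => x; rewrite modulus_restr.
have [s Ks] := compact_sub_cubes cK.
have mf := mnneg_modulus Lf.
pose h_ i x := \1_(@cube R n 1 (nth 0 s i)) x * modulus (f x).
have mh i : mnneg (h_ i).
  exact: (mnnegM (mnneg_indic R (measurable_cube 1 (nth 0 s i))) mf).
have mfK : mnneg (fun x => \1_K x * modulus (f x)).
  exact: (mnnegM (mnneg_indic R mK) mf).
have le_sum : {ae mu, forall x, \1_K x * modulus (f x) <= \sum_(i < size s) h_ i x}.
  apply: aeW => x; rewrite [leLHS](_ : _ = (x \in K)%:R * modulus (f x)) ?indicE//.
  have [xK|xK] := boolP (x \in K); last first.
    by rewrite mul0r; apply: sumr_ge0 => i _; exact: (mh i).2.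
  have [k ks xk] := Ks _ (set_mem xK); rewrite mul1r.
  have ks' : (index k s < size s)%N by rewrite index_mem.
  rewrite (bigD1 (Ordinal ks'))//= /h_ nth_index// indicE mem_set// mul1r lerDl.
  by apply: sumr_ge0 => i _; exact: (mh i).2.
apply: le_lt_trans (fs_le gaugeF mfK (mnneg_sum (size s) mh) le_sum) _.
apply: le_lt_trans (fs_sum_le gaugeF (size s) mh) _.
apply: lte_sum_pinfty => i _; apply: le_lt_trans foo; exact: gauge_cube_le.
Qed.

(** Local integrability is implied by the finiteness of the norm, so the space is
    exactly the set of measurable functions of finite norm. *)
Lemma fofanaE : fofana p q alpha =
  [set f | L0 f /\ (fofana_gauge (fun x => modulus (f x)) < +oo)%E].
Proof.
apply/seteqP; split => f.
  move=> [[Lf _]]; rewrite (fofana_normE f) => foo.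
  exact: (conj Lf foo).
move=> [Lf]; rewrite -(fofana_normE f) => foo.
exact: (conj (fofana_loc Lf foo) foo).
Qed.

End fofana_space.

Theorem theorem3p1 (R : realType) (n : nat) (p : euclid R n -> \bar R)
    (alpha q : \bar R)
    (p_exponent : variable_exponent p)
    (p_le_alpha : forall x, (p x <= alpha)%E)
    (alpha_le_q : (alpha <= q)%E) :
  banach_function_space (fofana p q alpha) (fofana_norm p q alpha) /\
  fatou_property (fofana p q alpha) (fofana_norm p q alpha).
Proof.
have q1 : (1 <= q)%E.
  exact: le_trans (p_exponent.2 0) (le_trans (p_le_alpha 0) alpha_le_q).
have nuF := fatou_seminorm_fofana alpha p_exponent q1.
have nu0 := @fofana_gauge_eq0 R n p alpha q p_exponent q1.
rewrite (fofanaE alpha p_exponent q1).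
rewrite (_ : fofana_norm p q alpha =
  fun f => fofana_gauge p alpha q (fun x => modulus (f x))); last first.
  by apply/funext => f; exact: fofana_normE.
split; last exact: fatou_property_modulus.
by split; [exact: normed_kothe_modulus|exact: norm_complete_modulus].
Qed.
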